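(* If $b=0$ then $$\Lambda=\max\left\{\frac1{R_\Omega},\frac1{K_\Omega}\right\}.$$ If either $K_\Omega=0$, or $K_\Omega\neq0$ with $b\neq0$ and $R_J\le1$, then $$\Lambda=\max\left\{\frac1{R_\Omega},\frac1{K_\Omega+1}\right\}.$$
   Context: $\Omega\subset\mathbb{R}^N$ is a bounded connected domain with $C^{1,\alpha}$ boundary. The kernel $J\colon\mathbb{R}^N\to\mathbb{R}$ is radially symmetric, nonnegative, continuous, compactly supported, with $J(0)>0$ and $\int_{\mathbb{R}^N}J(x)\,dx=1$. Let $R_J=\inf\{R: J(x)=0 \text{ in } \mathbb{R}^N\setminus B(0,R)\}\in(0,\infty)$ and assume $J(x)>0$ for $|x|<R_J$. Functions in $W^{1,\infty}_0(\Omega)$ are extended by $0$ to $\mathbb{R}^N\setminus\Omega$; $[u]_J=\sup\{|u(x)-u(y)|: x,y\in\mathbb{R}^N,\ x-y\in\operatorname{supp}(J)\}$ and $$\Lambda=\inf\left\{\frac{\max\{\|\nabla u\|_\infty,[u]_J\}}{\|u\|_\infty}: u\in W^{1,\infty}_0(\Omega)\setminus\{0\}\right\}.$$ The inradius is $R_\Omega=\max\{\operatorname{dist}(x,\partial\Omega): x\in\overline{\Omega}\}$, and $K_\Omega\in\mathbb{N}\cup\{0\}$, $b\in[0,R_J)$ are the quotient and remainder defined by $R_\Omega=K_\Omega R_J+b$. *)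

(* Defs.v *)
From HB Require Import structures.
From mathcomp Require Import all_boot all_order all_algebra.
From mathcomp Require Import all_classical all_reals all_analysis.

Set Implicit Arguments.
Unset Strict Implicit.
Unset Printing Implicit Defensive.
Import Order.TTheory GRing.Theory Num.Theory.
Import numFieldNormedType.Exports.
Local Open Scope classical_set_scope.
Local Open Scope ring_scope.

Definition measure_rV_display : measure_display -> measure_display.
Proof. exact. Qed.

(* The product sigma-algebra on row vectors, generated by the coordinates, as
   the library does for n.-tuple; over the Borel sets of R it is the Borel
   sigma-algebra of R^n. *)
Section measurable_rV.
Context {d} {T : measurableType d}.
Variable n : nat.

Let coors : 'I_n -> 'rV[T]_n -> T := fun i x => x ord0 i.

Let rV_set0 : g_sigma_preimage coors set0.
Proof. exact: sigma_algebra0. Qed.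

Let rV_setC A : g_sigma_preimage coors A -> g_sigma_preimage coors (~` A).
Proof. exact: sigma_algebraC. Qed.

Let rV_bigcup (F : _^nat) : (forall i, g_sigma_preimage coors (F i)) ->
  g_sigma_preimage coors (\bigcup_i (F i)).
Proof. exact: sigma_algebra_bigcup. Qed.

HB.instance Definition _ := @isMeasurable.Build (measure_rV_display d)
  'rV[T]_n (g_sigma_preimage coors) rV_set0 rV_setC rV_bigcup.

Lemma measurable_coord (i : 'I_n) :
  measurable_fun [set: 'rV[T]_n] (fun x : 'rV[T]_n => x ord0 i).
Proof.
move=> _ A mA; rewrite setTI; apply: sub_sigma_algebra.
by rewrite (bigD1 i) //=; left; exists A => //; rewrite setTI.
Qed.

Lemma measurable_fun_rV d' (S : measurableType d') (f : S -> 'rV[T]_n) :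
  (forall i, measurable_fun [set: S] (fun x => f x ord0 i)) ->
  measurable_fun [set: S] f.
Proof.
move=> mf; apply: measurability => //.
move=> _ [A + <-]; rewrite setTI.
rewrite -bigcup_seq => -[i _ [B mB <-]].
by rewrite setTI; have := mf i measurableT B mB; rewrite setTI.
Qed.

End measurable_rV.

Section lebesgue_rV.
Variable R : realType.
Local Notation mR := (measurableTypeR R).
Local Open Scope ereal_scope.

Definition consr (n : nat) (p : mR * 'rV[R]_n) : 'rV[R]_n.+1 :=
  \row_i oapp (p.2 ord0) p.1 (unlift ord0 i).

Definition unconsr (n : nat) (x : 'rV[R]_n.+1) : mR * 'rV[R]_n :=
  (x ord0 ord0, \row_j x ord0 (lift ord0 j)).

Lemma consrK n : cancel (@consr n) (@unconsr n).
Proof.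
move=> [a y]; rewrite /unconsr; congr pair; first by rewrite mxE unlift_none.
by apply/rowP => j; rewrite !mxE liftK.
Qed.

Lemma measurable_consr n : measurable_fun setT (@consr n).
Proof.
apply: measurable_fun_rV => i.
case: (unliftP ord0 i) => [j|] ->.
- have -> : (fun p => @consr n p ord0 (lift ord0 j)) =
            (fun y : 'rV[R]_n => y ord0 j) \o snd.
    by apply/funext => p /=; rewrite mxE liftK.
  exact: measurableT_comp (measurable_coord j) measurable_snd.
- have -> : (fun p => @consr n p ord0 ord0) = fst.
    by apply/funext => p /=; rewrite mxE unlift_none.
  exact: measurable_fst.
Qed.

Lemma measurable_unconsr n : measurable_fun setT (@unconsr n).
Proof.
apply: measurable_fun_pair; first exact: measurable_coord.
apply: measurable_fun_rV => j.
have -> : (fun x : 'rV[R]_n.+1 => (\row_j x ord0 (lift ord0 j)) ord0 j) =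
          (fun x : 'rV[R]_n.+1 => x ord0 (lift ord0 j)).
  by apply/funext => x; rewrite mxE.
exact: measurable_coord.
Qed.

Section step.
Variables (n : nat) (m : {sigma_finite_measure set 'rV[R]_n -> \bar R}).

Definition leb_step : set 'rV[R]_n.+1 -> \bar R :=
  pushforward (@lebesgue_measure R \x m) (@consr n).

HB.instance Definition _ := Measure.copy leb_step
  (measure_function_pushforward__canonical__measure_function_Measure
    (@lebesgue_measure R \x m) (@measurable_consr n)).

Let leb_step_sigma_finite : sigma_finite setT leb_step.
Proof.
have /sigma_finiteP[F [TF ndF mF]] := sigma_finiteT (@lebesgue_measure R).
have /sigma_finiteP[G [TG ndG mG]] := sigma_finiteT m.
exists (fun i => @unconsr n @^-1` (F i `*` G i)).
  rewrite -preimage_bigcup [X in _ @^-1` X](_ : _ = setT) ?preimage_setT//.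
  apply/seteqP; split => // -[x y] _.
  have : setT x by []. rewrite TF => -[i _ Fx].
  have : setT y by []. rewrite TG => -[j _ Gy].
  exists (maxn i j) => //; split.
  - by move: x Fx; exact/subsetPset/ndF/leq_maxl.
  - by move: y Gy; exact/subsetPset/ndG/leq_maxr.
move=> i; have [mFi Foo] := mF i; have [mGi Goo] := mG i; split.
  rewrite -[X in measurable X]setTI; apply: measurable_unconsr => //.
  exact: measurableX.
rewrite /leb_step /pushforward -comp_preimage.
rewrite (_ : _ \o _ = id); last first.
  by apply/funext => p; exact: consrK.
rewrite preimage_id product_measure1E// lte_mul_pinfty//.
by rewrite ge0_fin_numE.
Qed.

HB.instance Definition _ :=
  Measure_isSigmaFinite.Build _ _ _ leb_step leb_step_sigma_finite.
End step.

(* leb_step transports the product measure from R * R^n to R^(n+1), so this is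
   the iterated product of the one-dimensional Lebesgue measure. *)
Fixpoint lebesgue_rV (n : nat) : {sigma_finite_measure set 'rV[R]_n -> \bar R} :=
  if n is n'.+1 then leb_step (lebesgue_rV n') else \d_(0%R : 'rV[R]_0).

End lebesgue_rV.

Section euclidean.
Context {R : realType}.

(* The norm `|x| of the library on row vectors is the sup norm; it induces the
   same topology and the same bounded sets as the Euclidean norm. *)
Definition enorm N (x : 'rV[R]_N) : R := Num.sqrt (\sum_i x ord0 i ^+ 2).

Definition eball N (x : 'rV[R]_N) (r : R) : set 'rV[R]_N :=
  [set y | enorm (y - x) < r].

Definition bdry N (A : set 'rV[R]_N) : set 'rV[R]_N := closure A `\` interior A.

Definition dist_to N (x : 'rV[R]_N) (A : set 'rV[R]_N) : R :=
  inf [set enorm (x - y) | y in A].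

(* For a bounded nonempty Omega the supremum is a maximum. *)
Definition inradius N (Omega : set 'rV[R]_N) : R :=
  sup [set dist_to x (bdry Omega) | x in closure Omega].

Definition partial N (i : 'I_N) (f : 'rV[R]_N -> R) (x : 'rV[R]_N) : R :=
  'D_(delta_mx ord0 i) f x.

Definition grad N (f : 'rV[R]_N -> R) (x : 'rV[R]_N) : 'rV[R]_N :=
  \row_i partial i f x.

Definition supp N (f : 'rV[R]_N -> R) : set 'rV[R]_N :=
  closure [set x | f x != 0].

Fixpoint is_Ck (k : nat) N (f : 'rV[R]_N -> R) : Prop :=
  continuous f /\
  if k is k'.+1 then
    forall i : 'I_N, (forall x, derivable f x (delta_mx ord0 i)) /\
                     is_Ck k' (partial i f)
  else True.

(* phi belongs to C_c^infty(Omega). *)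
Definition test_function N (Omega : set 'rV[R]_N) (phi : 'rV[R]_N -> R) : Prop :=
  [/\ forall k, is_Ck k phi, compact (supp phi) & supp phi `<=` Omega].

(* g is C^{1,alpha} on the ball of center 0 and radius r. Hoelder continuity of
   the partial derivatives entails that they are continuous. *)
Definition C1alpha_on_ball N (alpha r : R) (g : 'rV[R]_N -> R) : Prop :=
  (forall y, eball 0 r y -> forall i, derivable g y (delta_mx ord0 i)) /\
  exists C : R, forall y z, eball 0 r y -> eball 0 r z -> forall i,
    `|partial i g y - partial i g z| <= C * enorm (y - z) `^ alpha.

(* Near each boundary point, and after a rigid motion x |-> (x - x0) *m Q,
   Omega is the strict epigraph of a C^{1,alpha} function; the first coordinate
   is the direction of the graph and col' ord0 gives the other ones. *)
Definition C1alpha_boundary n (alpha : R) (Omega : set 'rV[R]_n.+1) : Prop :=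
  forall x0, bdry Omega x0 ->
  exists (r : R) (Q : 'M[R]_n.+1) (g : 'rV[R]_n -> R),
    [/\ 0 < r, Q *m Q^T = 1%:M, C1alpha_on_ball alpha r g &
        forall x, eball x0 r x ->
          let y := (x - x0) *m Q in
          Omega x <-> g (col' ord0 y) < y ord0 ord0].

End euclidean.

Section sobolev.
Context {R : realType} {N : nat}.
Implicit Types (Omega : set 'rV[R]_N) (u J : 'rV[R]_N -> R).
Implicit Types (G : 'rV[R]_N -> 'rV[R]_N) (p : \bar R).
Local Notation leb := (lebesgue_rV R N).

Definition Lp_norm Omega p u : \bar R := ('N[leb]_p[EFin \o (u \_ Omega)])%E.

Definition weak_gradient Omega u G : Prop :=
  forall phi, test_function Omega phi -> forall i : 'I_N,
    \int[leb]_(x in Omega) (u x * partial i phi x) =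
    - \int[leb]_(x in Omega) (G x ord0 i * phi x).

(* u belongs to W^{1,p}(Omega) and G is its weak gradient. *)
Definition W1 Omega p u G : Prop :=
  [/\ measurable_fun Omega u, (Lp_norm Omega p u < +oo)%E,
      measurable_fun Omega G, (Lp_norm Omega p (fun x => enorm (G x)) < +oo)%E &
      weak_gradient Omega u G].

(* u belongs to W^{1,p}_0(Omega), the closure of C_c^infty(Omega) in
   W^{1,p}(Omega), and G is its weak gradient. Used for finite p. *)
Definition W10 Omega p u G : Prop :=
  W1 Omega p u G /\
  exists phi : nat -> 'rV[R]_N -> R,
    [/\ forall k, test_function Omega (phi k),
        Lp_norm Omega p (fun x => u x - phi k x) @[k --> \oo] --> 0%E &
        Lp_norm Omega p (fun x => enorm (G x - grad (phi k) x)) @[k --> \oo]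
          --> 0%E].

(* u is the extension by 0 of an element of
   W^{1,oo}_0(Omega) = W^{1,oo}(Omega) `&` W^{1,1}_0(Omega), with weak gradient
   G. The class of u modulo equality almost everywhere is represented by its
   continuous member, for which the pointwise supremum in jump_seminorm makes
   sense. (The closure of C_c^infty(Omega) for the norm of W^{1,oo} would only
   contain C^1 functions.) *)
Definition W1oo0 Omega u G : Prop :=
  [/\ continuous u, forall x, ~ Omega x -> u x = 0,
      W1 Omega +oo%E u G & W10 Omega 1%E u G].

Definition jump_seminorm J u : R :=
  sup [set `|u z.1 - u z.2| | z in [set z | supp J (z.1 - z.2)]].

(* The three norms are finite for u in W^{1,oo}_0(Omega), so fine and the real
   sup do not hit their default values. *)
Definition Lambda Omega J : R :=
  inf [set q | exists u G,
    [/\ W1oo0 Omega u G, exists x, u x != 0 &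
        q = Num.max (fine (Lp_norm Omega +oo%E (fun x => enorm (G x))))
                    (jump_seminorm J u)
            / fine (Lp_norm Omega +oo%E u)]].

Definition radial J : Prop := forall x y, enorm x = enorm y -> J x = J y.

Definition kernel_radius J : R :=
  inf [set r | 0 < r /\ forall x, ~ eball 0 r x -> J x = 0].

Definition admissible_kernel J : Prop :=
  [/\ radial J, forall x, 0 <= J x, continuous J & compact (supp J)] /\
  [/\ 0 < J 0, (\int[leb]_x (J x)%:E = 1)%E &
      forall x, enorm x < kernel_radius J -> 0 < J x].

End sobolev.

(* Main.v *)
Require Import Defs.
From mathcomp Require Import all_boot all_order all_algebra.
From mathcomp Require Import all_classical all_reals all_analysis.
From mathcomp Require Import measurable_realfun lebesgue_integral_under ess_sup_inf.
From mathcomp Require Import ring lra.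
Set Implicit Arguments.
Unset Strict Implicit.
Unset Printing Implicit Defensive.
Import Order.TTheory GRing.Theory Num.Theory.
Import numFieldNormedType.Exports.
Local Open Scope classical_set_scope.
Local Open Scope ring_scope.

(** Write r for the kernel radius and rad for the inradius. The support of the
kernel is the closed ball of radius r, so the jump seminorm controls exactly the
increments over distances at most r.

Lower bounds. Let u be admissible, A the essential supremum of its gradient, B
its jump seminorm, and let y be a boundary point nearest to x. The open ball
around x through y lies in the domain, and on it u is A-Lipschitz; since
u y = 0, this gives |u x| <= A * dist <= A * rad. If rad <= m * r, the segment
from x to y can be cut into m pieces of length at most r, and |u x| <= m * B.
Hence every quotient is at least max(1/rad, 1/m). This is used with m = K when
b = 0 and with m = K + 1 otherwise.

Upper bound. Only the cone x |-> rad - |x - x0| over a largest inscribed ball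
matters: its slope is 1, its height is rad, and its jumps are at most
min(r, rad), so its quotient is max(1, min(r, rad)) / rad. In each of the cases
of the theorem this is at most the lower bound: if b = 0 then r / rad = 1 / K,
if K = 0 then rad / rad = 1, and if r <= 1 then the quotient is 1 / rad. The cone
is replaced by smooth, compactly supported functions with nearly the same
height (lemma cone_quotient). Such a function is a test function, hence belongs
to the Sobolev space with its classical gradient (lemma
test_function_W1oo0), by integration by parts.

The analytic core of the lower bound is lemma weak_gradient_lipschitz. It is
obtained by testing the weak gradient against a bump that slides from x to
x + v: t |-> int u(z) * bump(x + t v)(z) dz has derivative
int (G . v) * bump, which is at most A |v| int bump, so the mean value theorem
bounds the increment, and shrinking the bump recovers u by continuity. Both
this computation and integration by parts rest on the translation invariance
of Lebesgue measure and on differentiation under the integral sign. *)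

(** * Euclidean norm *)

Section euclidean_norm.
Context {R : realType} {N : nat}.
Implicit Types x y : 'rV[R]_N.

Lemma enorm_ge0 x : 0 <= enorm x. Proof. exact: sqrtr_ge0. Qed.

Lemma sqr_enorm x : enorm x ^+ 2 = \sum_i x ord0 i ^+ 2.
Proof. by rewrite sqr_sqrtr// sumr_ge0// => i _; exact: sqr_ge0. Qed.

Lemma enorm0 : enorm (0 : 'rV[R]_N) = 0.
Proof.
rewrite /enorm big1 ?sqrtr0// => i _.
by rewrite mxE expr0n.
Qed.

Lemma enormZ (a : R) x : enorm (a *: x) = `|a| * enorm x.
Proof.
rewrite /enorm -sqrtr_sqr -sqrtrM ?sqr_ge0// mulr_sumr; congr Num.sqrt.
by apply: eq_bigr => i _; rewrite mxE exprMn.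
Qed.

Lemma enormN x : enorm (- x) = enorm x.
Proof. by rewrite -scaleN1r enormZ normrN normr1 mul1r. Qed.

Lemma enormB x y : enorm (x - y) = enorm (y - x).
Proof. by rewrite -enormN opprB. Qed.

Lemma le_coord_enorm x i : `|x ord0 i| <= enorm x.
Proof.
rewrite -sqrtr_sqr ler_wsqrtr// (bigD1 i)//= lerDl.
by rewrite sumr_ge0// => j _; exact: sqr_ge0.
Qed.

Lemma le_norm_enorm x : `|x| <= enorm x.
Proof.
rewrite -[leLHS]/(mx_norm x) mx_normrE; apply/bigmax_leP; split => /=.
  exact: enorm_ge0.
by move=> [i j] _; rewrite [i]ord1; exact: le_coord_enorm.
Qed.

Lemma le_coord_norm x i : `|x ord0 i| <= `|x|.
Proof.
rewrite -[leRHS]/(mx_norm x) mx_normrE; apply/bigmax_geP; right => /=.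
by exists (ord0, i).
Qed.

(** A crude constant is enough: this comparison serves only to identify the two
topologies. *)
Lemma le_enorm_norm x : enorm x <= N%:R * `|x|.
Proof.
rewrite -[leRHS]ger0_norm ?mulr_ge0// -sqrtr_sqr ler_wsqrtr// exprMn.
apply: (@le_trans _ _ (\sum_(i < N) `|x| ^+ 2)).
  apply: ler_sum => i _; rewrite -real_normK ?num_real//.
  by rewrite lerXn2r ?nnegrE// le_coord_norm.
rewrite sumr_const card_ord -[leLHS]mulr_natl ler_wpM2r ?sqr_ge0//.
by rewrite -natrX ler_nat; case: (N) => // k; rewrite leq_pmulr.
Qed.

(** Expanding the square sum of |x|^2 y - (x . y) x, which is nonnegative, gives
|x|^2 (|x|^2 |y|^2 - (x . y)^2). *)
Lemma cauchy_schwarz x y :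
  `|\sum_i x ord0 i * y ord0 i| <= enorm x * enorm y.
Proof.
have [x0|x0] := eqVneq (enorm x) 0.
  rewrite big1 ?normr0 ?mulr_ge0 ?enorm_ge0// => i _.
  by have := le_coord_enorm x i; rewrite x0 normr_le0 => /eqP ->; rewrite mul0r.
have xp : 0 < enorm x by rewrite lt_neqAle eq_sym x0 enorm_ge0.
set s := \sum_i _.
rewrite -ler_sqr ?nnegrE ?mulr_ge0 ?enorm_ge0// exprMn real_normK ?num_real//.
have : 0 <= \sum_i (enorm x ^+ 2 * y ord0 i - s * x ord0 i) ^+ 2.
  by rewrite sumr_ge0// => i _; exact: sqr_ge0.
have -> : \sum_i (enorm x ^+ 2 * y ord0 i - s * x ord0 i) ^+ 2 =
  enorm x ^+ 2 * (enorm x ^+ 2 * enorm y ^+ 2 - s ^+ 2).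
  have -> : enorm x ^+ 2 * (enorm x ^+ 2 * enorm y ^+ 2 - s ^+ 2) =
    enorm x ^+ 4 * enorm y ^+ 2 - (2 * s * enorm x ^+ 2) * s
    + s ^+ 2 * enorm x ^+ 2 by ring.
  have sE c : c * s = \sum_i c * (x ord0 i * y ord0 i) by rewrite mulr_sumr.
  move: s sE => s sE; rewrite [enorm y ^+ 2]sqr_enorm [_ * _ ^+ 2 * s]sE.
  rewrite [X in _ = _ + _ * X]sqr_enorm.
  rewrite !mulr_sumr -sumrN -!big_split/=.
  by apply: eq_bigr => i _; ring.
by rewrite pmulr_rge0 ?exprn_gt0// subr_ge0.
Qed.

Lemma ler_enormD x y : enorm (x + y) <= enorm x + enorm y.
Proof.
rewrite -ler_sqr ?nnegrE ?addr_ge0 ?enorm_ge0//.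
rewrite sqr_enorm sqrrD !sqr_enorm.
under eq_bigr do rewrite mxE sqrrD.
rewrite !big_split/= lerD2r lerD2l mulr2n lerD//;
by apply: le_trans (cauchy_schwarz x y); exact: ler_norm.
Qed.

Lemma ler_enorm_dist x y : `|enorm x - enorm y| <= enorm (x - y).
Proof.
have h (a b : 'rV[R]_N) : enorm a - enorm b <= enorm (a - b).
  by rewrite lerBlDr -[a in leLHS](subrK b) ler_enormD.
by rewrite ler_norml lerNl opprB [in X in X && _]enormB !h.
Qed.

Lemma enorm_eq0 x : enorm x = 0 -> x = 0.
Proof.
move=> x0; apply/rowP => i; rewrite mxE; apply/eqP.
by rewrite -normr_le0 -x0 le_coord_enorm.
Qed.

Lemma continuous_lipschitz (f : 'rV[R]_N -> R) (C : R) : 0 <= C ->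
  (forall x y, `|f x - f y| <= C * enorm (x - y)) -> continuous f.
Proof.
move=> C0 fC x; apply/(@cvgrPdist_lt _ _ _ (nbhs x)) => /= e e0.
have D0 : 0 < (C + 1) * (N%:R + 1) :> R by rewrite mulr_gt0// ltr_wpDl.
near=> y; apply: le_lt_trans (fC _ _) _.
apply: (@le_lt_trans _ _ (((C + 1) * (N%:R + 1)) * `|x - y|)).
  rewrite -mulrA; apply: ler_pM => //; first exact: enorm_ge0.
    by rewrite lerDl.
  by apply: le_trans (le_enorm_norm _) _; rewrite ler_wpM2r// lerDl.
rewrite mulrC -ltr_pdivlMr//; near: y.
by apply: cvgr_dist_lt; rewrite ?divr_gt0.
Unshelve. all: by end_near. Qed.

Lemma continuous_enorm : continuous (@enorm R N).
Proof.
apply: (@continuous_lipschitz _ 1) => // x y.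
by rewrite mul1r; exact: ler_enorm_dist.
Qed.

Lemma eball_nbhs x (r : R) : 0 < r -> nbhs x (eball x r).
Proof.
move=> r0; have D0 : 0 < N%:R + 1 :> R by rewrite ltr_wpDl.
apply/nbhs_ballP; exists (r / (N%:R + 1)) => /=; first by rewrite divr_gt0.
move=> y; rewrite mx_norm_ball /ball_ /eball/= => xy.
apply: le_lt_trans (le_enorm_norm _) _; rewrite distrC.
apply: (@le_lt_trans _ _ ((N%:R + 1) * `|x - y|)).
  by rewrite ler_wpM2r// lerDl.
by rewrite mulrC -ltr_pdivlMr.
Qed.

(** Euclidean balls form a basis of the topology defined by the sup norm. *)
Lemma nbhs_eballP x (A : set 'rV[R]_N) :
  nbhs x A <-> exists2 r, 0 < r & eball x r `<=` A.
Proof.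
split=> [/nbhs_ballP[r /= r0 rA]|[r r0 rA]]; last first.
  by apply: filterS rA _; exact: eball_nbhs.
exists r => // y; rewrite /eball/= => xy; apply: rA.
rewrite mx_norm_ball /ball_/= distrC.
by apply: le_lt_trans xy; exact: le_norm_enorm.
Qed.

Lemma open_eball x r : open (eball x r).
Proof.
rewrite openE => y; rewrite /eball/= => yr; apply/nbhs_eballP.
exists (r - enorm (y - x)); first by rewrite subr_gt0.
move=> z; rewrite /eball/= => zy.
rewrite -(subrK y z) -addrA.
by apply: le_lt_trans (ler_enormD _ _) _; rewrite -ltrBrDr.
Qed.

Lemma eball_center x (r : R) : 0 < r -> eball x r x.
Proof. by move=> r0; rewrite /eball/= subrr enorm0. Qed.

End euclidean_norm.

(** * Lebesgue measure of open sets *)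

Section lebesgue_rV.
Context {R : realType}.
Local Notation leb := (lebesgue_rV R).

(** Open balls of the sup norm, written coordinatewise so that they are visibly
measurable for the product sigma-algebra. *)
Definition cube N (c : 'rV[R]_N) (e : R) : set 'rV[R]_N :=
  [set x | forall i, `|x ord0 i - c ord0 i| < e].

Lemma measurable_cube N (c : 'rV[R]_N) e : measurable (cube c e).
Proof.
have -> : cube c e = \bigcap_(i in [set: 'I_N])
    ((fun x : 'rV[R]_N => x ord0 i) @^-1` (ball (c ord0 i) e)).
  apply/seteqP; split => x /= xc i; last by move: (xc i I); rewrite /ball/= distrC.
  by move=> _; rewrite /ball/= distrC; exact: xc.
apply: fin_bigcap_measurable => // i _.
rewrite -[X in measurable X]setTI; apply: measurable_coord => //.
by rewrite ball_itv; exact: measurable_itv.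
Qed.

(** An open set is the union of the cubes with rational center and radius
1/(k+1) that it contains, and there are countably many of them. *)
Lemma open_measurable_rV N (A : set 'rV[R]_N) : open A -> measurable A.
Proof.
move=> oA.
pose F (qk : 'rV[rat]_N * nat) : set 'rV[R]_N :=
  let C := cube (map_mx ratr qk.1) qk.2.+1%:R^-1 in
  if `[< C `<=` A >] then C else set0.
have -> : A = \bigcup_qk F qk.
  apply/seteqP; split => [x Ax|x [[q k] _]]; last first.
    by rewrite /F; case: ifPn => // /asboolP; exact.
  have /nbhs_ballP[r /= r0 rA] : nbhs x A by exact: open_nbhs_nbhs.
  have [k kr] : exists k : nat, k.+1%:R^-1 < r / 2.
    have [|k] := @ltr_add_invr R 0 (r / 2); first by rewrite divr_gt0.
    by rewrite add0r; exists k.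
  have k0 : 0 < k.+1%:R^-1 :> R by rewrite invr_gt0.
  have /choice[q qP] : forall i : 'I_N, exists q : rat,
      `|x ord0 i - ratr q| < k.+1%:R^-1.
    move=> i.
    have [q] : exists q : rat, ratr q \in
       `](x ord0 i - k.+1%:R^-1), (x ord0 i + k.+1%:R^-1)[.
      by apply: rat_in_itvoo; rewrite ltrBlDr -addrA ltrDl addr_gt0.
    rewrite in_itv/= => /andP[q1 q2]; exists q.
    by rewrite distrC ltr_distl q1.
  have Cx : cube (map_mx ratr (\row_i q i)) k.+1%:R^-1 x.
    by move=> i; rewrite !mxE; exact: qP.
  exists (\row_i q i, k) => //; rewrite /F; case: ifPn => // /asboolPn; case.
  move=> y Cy; apply: rA; rewrite mx_norm_ball /ball_/=.
  rewrite -[X in X < _]/(mx_norm (x - y)) mx_normrE; apply/bigmax_ltP; split=> //=.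
  move=> [i j] _; rewrite [i]ord1 !mxE/=.
  rewrite -(subrK (ratr (q j)) (x ord0 j)) -addrA.
  apply: le_lt_trans (ler_normD _ _) _.
  have := Cx j; have := Cy j; rewrite !mxE/= (distrC (ratr (q j)) (y _ _)).
  by move=> hy hx; apply: lt_trans (ltrD hx hy) _; rewrite [ltRHS]splitr ltrD.
apply: countable_bigcupT_measurable; first exact: countableP.
move=> qk; rewrite /F; case: ifPn => // _; exact: measurable_cube.
Qed.

Lemma measurable_fun_continuous N (f : 'rV[R]_N -> R) :
  continuous f -> measurable_fun setT f.
Proof.
move=> cf; apply: (measurability _ (measurable_realfun.RGenOpens.measurableE R)) => /=.
move=> _ [_ [a [b ->] <-]]; rewrite setTI; apply: open_measurable_rV.
move/continuousP : cf; apply; exact: interval_open.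
Qed.

(** Induction on the dimension: a cube is the product of an interval and a cube of
one dimension less. *)
Lemma lebesgue_rV_cube N (c : 'rV[R]_N) (e : R) : 0 < e ->
  leb N (cube c e) = ((2 * e) ^+ N)%:E.
Proof.
move=> e0; elim: N c => [|N IH] c.
  by rewrite /= diracE mem_set// => -[].
rewrite /= /leb_step /pushforward.
have -> : @consr R N @^-1` cube c e =
  `](c ord0 ord0 - e), (c ord0 ord0 + e)[%classic
    `*` cube (\row_j c ord0 (lift ord0 j)) e.
  apply/seteqP; split=> [[a y] /= h|[a y] [/= ha hy] i].
    split.
      by rewrite /= in_itv/= -ltr_distl; have := h ord0; rewrite mxE unlift_none.
    by move=> j; have := h (lift ord0 j); rewrite !mxE liftK.
  case: (unliftP ord0 i) => [j|] ->; rewrite mxE ?liftK ?unlift_none/=.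
    by have := hy j; rewrite mxE.
  by move: ha; rewrite in_itv/= -ltr_distl.
rewrite product_measure1E//; last exact: measurable_cube.
have itvE : lebesgue_measure `](c ord0 ord0 - e), (c ord0 ord0 + e)[%classic =
    (2 * e)%:E.
  rewrite lebesgue_measure_itv/= lte_fin ifT; last first.
    by rewrite ltrBlDr -addrA ltrDl addr_gt0.
  by rewrite -EFinB; congr (_%:E); ring.
by rewrite [X in (X * _)%E]itvE [X in (_ * X)%E]IH -EFinM exprS.
Qed.

Lemma lebesgue_rV_open_gt0 N (A : set 'rV[R]_N) : open A -> A !=set0 ->
  (0 < leb N A)%E.
Proof.
move=> oA [x Ax].
have /nbhs_ballP[r /= r0 rA] : nbhs x A by exact: open_nbhs_nbhs.
apply: (@lt_le_trans _ _ (leb N (cube x r))).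
  by rewrite lebesgue_rV_cube// lte_fin exprn_gt0// mulr_gt0.
apply: le_measure; rewrite ?inE; [exact: measurable_cube| |].
  exact: open_measurable_rV.
move=> y Cy; apply: rA; rewrite mx_norm_ball /ball_/=.
rewrite -[X in X < _]/(mx_norm (x - y)) mx_normrE; apply/bigmax_ltP; split=> //=.
by move=> [i j] _; rewrite [i]ord1 !mxE/= distrC; exact: Cy.
Qed.

End lebesgue_rV.

(** * Translation invariance and integrability *)

Section translation.
Context {R : realType}.
Local Notation leb := (lebesgue_rV R).

(** Both sides are measures that agree on half-open intervals. *)
Lemma lebesgue_measure_translate (a : R) (A : set R) : measurable A ->
  lebesgue_measure ((fun x : R => x + a) @^-1` A) = lebesgue_measure A.
Proof.
move=> mA.
have mD : measurable_fun [set: measurableTypeR R]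
    ((fun x => x + a) : _ -> measurableTypeR R).
  by apply: measurable_funD => //; exact: measurable_cst.
pose m := measure_function_pushforward__canonical__measure_function_Measure
  (@lebesgue_measure R) mD.
apply/esym; apply: (@lebesgue_measure_unique R m) => //= _ [[b c]] _ <-.
rewrite /m/= /pushforward.
have -> : (fun x => x + a) @^-1` `]b, c] = `]b - a, c - a]%classic.
  by apply/seteqP; split=> x; rewrite /= !in_itv/= ltrBlDr lerBrDr.
rewrite !lebesgue_measure_itv/= !lte_fin ltrD2r.
by case: ifPn => // _; rewrite -!EFinB; congr (_%:E); ring.
Qed.

Lemma ge0_integral_translate (a : R) (f : R -> \bar R) :
  measurable_fun [set: R] f -> (forall x, 0 <= f x)%E ->
  (\int[@lebesgue_measure R]_x f (x + a)%R = \int[@lebesgue_measure R]_x f x)%E.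
Proof.
move=> mf f0.
have mD : measurable_fun [set: measurableTypeR R]
    ((fun x => x + a) : _ -> measurableTypeR R).
  by apply: measurable_funD => //; exact: measurable_cst.
have := @ge0_integral_pushforward _ _ _ _ _ _ mD lebesgue_measure setT f
  measurableT mf (fun x _ => f0 x).
rewrite preimage_setT => /= <-.
by apply: eq_measure_integral => A mA _; exact: lebesgue_measure_translate.
Qed.

Lemma measurable_translate_rV N (v : 'rV[R]_N) :
  measurable_fun setT (fun x : 'rV[R]_N => x + v).
Proof.
apply: measurable_fun_rV => i.
under [X in measurable_fun _ X]eq_fun do rewrite mxE.
by apply: measurable_funD; [exact: measurable_coord|exact: measurable_cst].
Qed.

(** Induction on the dimension: the measure is the integral of the measures of the
sections, the sections are translated inside R^n, and the resulting function of
the first coordinate is translated in R. *)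
Lemma lebesgue_rV_translate N (v : 'rV[R]_N) (A : set 'rV[R]_N) :
  measurable A -> leb N ((fun x => x + v) @^-1` A) = leb N A.
Proof.
elim: N v A => [|N IH] v A mA.
  by rewrite (_ : (fun x => x + v) = id)//; apply/funext => x; apply/rowP => -[].
rewrite /= /leb_step /pushforward /= /product_measure1 /=.
pose B := @consr R N @^-1` A.
have mB : measurable B.
  by rewrite -[X in measurable X]setTI; exact: measurable_consr.
pose g a := leb N (xsection B a).
rewrite -[RHS](@ge0_integral_translate (v ord0 ord0) g)//; last first.
  exact: (@measurable_fun_xsection _ _ _ _ _ (leb N)).
apply: eq_integral => a _ /=.
rewrite /g -[RHS](IH (\row_j v ord0 (lift ord0 j))); last exact: measurable_xsection.
congr (leb N _).
apply/seteqP; split => y; rewrite /= /xsection/= !inE /B/=;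
  congr (A _); apply/rowP => i; rewrite !mxE;
  by case: (unliftP ord0 i) => [j|] ->; rewrite /= ?mxE.
Qed.

Lemma Rintegral_translate N (v : 'rV[R]_N) (f : 'rV[R]_N -> R) :
  (leb N).-integrable setT (EFin \o f) ->
  (leb N).-integrable setT (EFin \o (fun x => f (x + v))) /\
  \int[leb N]_x f (x + v) = \int[leb N]_x f x.
Proof.
move=> intf; have mf := measurable_int _ intf.
have mT := @measurable_translate_rV N v.
have eqm A : measurable A -> A `<=` setT ->
    pushforward (leb N) (fun x => x + v) A = leb N A.
  by move=> mA _; exact: lebesgue_rV_translate.
have intf' : (leb N).-integrable setT (EFin \o (fun x => f (x + v))).
  apply/integrableP; split.
    by apply: (measurableT_comp mf mT).
  move/integrableP : intf => [_]; apply: le_lt_trans.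
  rewrite -[leRHS](eq_measure_integral _ eqm) [leRHS]ge0_integral_pushforward//.
  exact: measurableT_comp.
split => //; rewrite /Rintegral; congr fine.
rewrite -[RHS](eq_measure_integral _ eqm).
by rewrite (integral_pushforward mT mf).
Qed.

Lemma integrable_bounded_support N (f : 'rV[R]_N -> R) (M C : R) :
  measurable_fun setT f -> (forall x, `|f x| <= C) ->
  (forall x, M <= enorm x -> f x = 0) ->
  (leb N).-integrable setT (EFin \o f).
Proof.
move=> mf fC fM.
have M0 : 0 < `|M| + 1 by rewrite ltr_wpDl.
have mc : measurable (cube (0 : 'rV[R]_N) (`|M| + 1)) by exact: measurable_cube.
have -> : EFin \o f = (EFin \o f) \_ (cube 0 (`|M| + 1)).
  apply/funext => x; rewrite patchE; case: ifPn => //= /negP xM.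
  rewrite fM// leNgt; apply/negP => xM'; apply: xM; rewrite inE => i.
  rewrite mxE subr0 (le_lt_trans (le_coord_enorm _ _))// (lt_le_trans xM')//.
  by rewrite (le_trans (ler_norm _))// lerDl.
apply/(integrable_mkcond _ mc); apply: measurable_bounded_integrable => //.
- by rewrite [X in (X < _)%E](@lebesgue_rV_cube _ N)// ltry.
- exact: measurable_funS mf.
- exists C; split; [exact: num_real|move=> y Cy x _ /=].
  by rewrite (le_trans (fC x))// ltW.
Qed.

End translation.

(** * Directional derivatives and C^k functions *)

Section directional_derivatives.
Context {R : realType} {V : normedModType R}.
Implicit Types (f : V -> R) (g : R -> R).

(** A directional derivative is a derivative in one real variable, which gives
access to the chain rule of the real line. *)
Lemma is_derive_line f x v d :
  is_derive (0 : R) 1 (fun h : R => f (h *: v + x)) d <-> is_derive x v f d.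
Proof.
have E : (fun h : R => h^-1 *: (((fun h : R => f (h *: v + x)) \o shift 0) (h *: 1)
      - f (0 *: v + x))) =
    (fun h : R => h^-1 *: ((f \o shift x) (h *: v) - f x)).
  by apply/funext => h /=; rewrite addr0 scale0r add0r [_%:A]mulr1.
split=> -[]; rewrite /derivable /derive.
  by rewrite E => df <-; apply: DeriveDef.
by move=> df <-; apply: DeriveDef; rewrite /derivable /derive E.
Qed.

Lemma is_derive_comp f g x v a b :
  is_derive x v f a -> is_derive (f x) 1 g b ->
  is_derive x v (g \o f) (b * a).
Proof.
move=> /is_derive_line fa gb; apply/is_derive_line.
apply: (@is_derive1_comp _ g (fun h : R => f (h *: v + x))).
by rewrite scale0r add0r.
Qed.

Lemma is_derive_ray f x v (t : R) d :
  is_derive (x + t *: v) v f d -> is_derive t 1 (fun s : R => f (x + s *: v)) d.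
Proof.
have E : (fun h : R => h^-1 *: (((fun s : R => f (x + s *: v)) \o shift t) (h *: 1)
      - f (x + t *: v))) =
    (fun h : R => h^-1 *: ((f \o shift (x + t *: v)) (h *: v) - f (x + t *: v))).
  by apply/funext => h /=; rewrite [_%:A]mulr1 scalerDl addrCA.
by case=> + <-; rewrite /derivable /derive -E => df; apply: DeriveDef.
Qed.

Lemma is_derive1_continuous g (t d : R) : is_derive t 1 g d -> {for t, continuous g}.
Proof. by case=> dg _; apply/differentiable_continuous/derivable1_diffP. Qed.

(** A quadratic bound makes the difference quotient at most C |h|. *)
Lemma is_derive1_sqr_bound g (C : R) : g 0 = 0 ->
  (forall h, `|g h| <= C * h ^+ 2) -> is_derive (0 : R) 1 g 0.
Proof.
move=> g0 gC.
have C0 : 0 <= C by have := le_trans (normr_ge0 _) (gC 1); rewrite expr1n mulr1.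
have lim0 : (fun h : R => h^-1 *: ((g \o shift 0) (h *: 1) - g 0)) @ 0^' --> (0 : R).
  apply/cvgrPdist_lt => /= e e0; near=> h.
  have h0 : h != 0 by near: h; exact: nbhs_dnbhs_neq.
  rewrite sub0r normrN g0 subr0 addr0 [_%:A]mulr1 normrZ normfV.
  rewrite ltr_pdivrMl ?normr_gt0// (le_lt_trans (gC h))//.
  rewrite -real_normK ?num_real// expr2 mulrA mulrC ltr_pM2l ?normr_gt0//.
  apply: (@le_lt_trans _ _ ((C + 1) * `|h|)); first by rewrite ler_wpM2r ?lerDl.
  rewrite mulrC -ltr_pdivlMr ?ltr_wpDl//; near: h.
  by apply: dnbhs0_lt; rewrite divr_gt0 ?ltr_wpDl.
by apply: DeriveDef; [apply/cvg_ex; exists 0|exact/cvg_lim].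
Unshelve. all: by end_near. Qed.

End directional_derivatives.

Section smooth.
Context {R : realType} {N : nat}.
Implicit Types f g : 'rV[R]_N -> R.

Lemma is_Ck_continuous k f : is_Ck k f -> continuous f.
Proof. by case: k => [|k] []. Qed.

Lemma is_CkW k f : is_Ck k.+1 f -> is_Ck k f.
Proof.
elim: k f => [|k IH] f; first by case.
by move=> [cf df]; split => // i; have [d1 d2] := df i; split => //; exact: IH.
Qed.

Lemma is_Ck_cst k (a : R) : is_Ck k (cst a : 'rV[R]_N -> R).
Proof.
elim: k a => [|k IH] a; split => //; try exact: cst_continuous.
move=> i; split; first by move=> x; apply: derivable_cst.
rewrite (_ : partial i _ = cst 0); first exact: IH.
by apply/funext => x; rewrite /partial derive_cst.
Qed.

Lemma is_derive_coord (i j : 'I_N) x :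
  is_derive x (delta_mx ord0 i) (fun y : 'rV[R]_N => y ord0 j) ((i == j)%:R).
Proof.
set f := fun y : 'rV[R]_N => _.
have lim : (fun h : R => h^-1 *: ((f \o shift x) (h *: delta_mx ord0 i) - f x))
    @ 0^' --> ((i == j)%:R : R).
  apply: cvg_near_cst; near=> h.
  have h0 : h != 0 by near: h; exact: nbhs_dnbhs_neq.
  by rewrite /f/= !mxE eqxx/= eq_sym addrK /GRing.scale/= mulrA mulVf// mul1r.
by apply: DeriveDef; [apply/cvg_ex; exists (i == j)%:R|exact/cvg_lim].
Unshelve. all: by end_near. Qed.

Lemma is_Ck_coord k (j : 'I_N) : is_Ck k (fun x : 'rV[R]_N => x ord0 j).
Proof.
case: k => [|k]; split => //; try exact: coord_continuous.
move=> i; split; first by move=> x; have [] := is_derive_coord i j x.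
rewrite (_ : partial i _ = cst ((i == j)%:R)); first exact: is_Ck_cst.
by apply/funext => x; rewrite /partial; have [_ ->] := is_derive_coord i j x.
Qed.

Lemma is_CkD k f g : is_Ck k f -> is_Ck k g -> is_Ck k (f + g).
Proof.
elim: k f g => [|k IH] f g [cf df] [cg dg]; split => //;
  try by move=> x; apply: continuousD; [exact: cf|exact: cg].
move=> i; have [df1 df2] := df i; have [dg1 dg2] := dg i.
split; first by move=> x; apply: derivableD.
rewrite (_ : partial i _ = partial i f + partial i g); first exact: IH.
by apply/funext => x; rewrite /partial deriveD.
Qed.

(** The induction needs both factors with one order less, hence the weakening
is_CkW. *)
Lemma is_CkM k f g : is_Ck k f -> is_Ck k g -> is_Ck k (f * g).
Proof.
elim: k f g => [|k IH] f g Cf Cg; have [cf df] := Cf; have [cg dg] := Cg;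
  split => //; try by move=> x; apply: continuousM; [exact: cf|exact: cg].
move=> i; have [df1 df2] := df i; have [dg1 dg2] := dg i.
split; first by move=> x; apply: derivableM.
rewrite (_ : partial i _ = f * partial i g + g * partial i f).
  by apply: is_CkD; apply: IH => //; exact: is_CkW.
by apply/funext => x; rewrite /partial deriveM.
Qed.

Lemma is_CkZ k (a : R) f : is_Ck k f -> is_Ck k (fun x => a * f x).
Proof. by move=> Cf; apply: (is_CkM (is_Ck_cst k a) Cf). Qed.

Lemma is_Ck_sum k (I : Type) (r : seq I) (F : I -> 'rV[R]_N -> R) :
  (forall i, is_Ck k (F i)) -> is_Ck k (fun x => \sum_(i <- r) F i x).
Proof.
move=> CF; elim: r => [|i r IH].
  rewrite (_ : (fun _ => _) = cst 0); first exact: is_Ck_cst.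
  by apply/funext => x; rewrite big_nil.
rewrite (_ : (fun _ => _) = F i + (fun x => \sum_(j <- r) F j x)).
  exact: is_CkD.
by apply/funext => x; rewrite big_cons.
Qed.

(** A smooth function on D, given with all its derivatives: g 0 is the function and
g j its j-th derivative. This lets the composition lemma below be proved by an
induction that only moves along the sequence. *)
Definition derivative_chain (D : set R) (g : nat -> R -> R) :=
  forall j t, D t -> is_derive t 1 (g j) (g j.+1 t).

Lemma is_Ck_comp D (g : nat -> R -> R) f : derivative_chain D g ->
  (forall x, D (f x)) -> forall k, is_Ck k f -> forall j, is_Ck k (g j \o f).
Proof.
move=> Dg Df.
have cgf j : continuous f -> continuous (g j \o f).
  move=> cf x; apply: continuous_comp; first exact: cf.
  by have /is_derive1_continuous := Dg j _ (Df x).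
elim=> [|k IH] Cf j; have [cf df] := Cf; split => //; try exact: cgf.
move=> i; have [df1 df2] := df i.
have dgf x := is_derive_comp (derivableP (df1 x)) (Dg j _ (Df x)).
split; first by move=> x; have [] := dgf x.
rewrite (_ : partial i _ = (g j.+1 \o f) * partial i f).
  by apply: is_CkM => //; apply: IH; exact: is_CkW.
by apply/funext => x; rewrite /partial; have [_ ->] := dgf x.
Qed.

End smooth.

(** * Flat functions and the square root *)

Section flat_functions.
Context {R : realType}.
Implicit Types (p : {poly R}) (t : R).

(** Half of the exponential decay absorbs each additional factor y, hence the
general rate a in the induction on p. *)
Lemma horner_expR_bounded p (a : R) : 0 < a ->
  exists C, forall y, 0 <= y -> `|p.[y]| * expR (- (a * y)) <= C.
Proof.
elim/poly_ind: p a => [|p c IH] a a0.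
  by exists 0 => y _; rewrite horner0 normr0 mul0r.
have a2 : 0 < a / 2 by rewrite divr_gt0.
have [C CP] := IH _ a2; exists (C * (a / 2)^-1 + `|c|) => y y0.
rewrite !hornerE; apply: (@le_trans _ _
  ((`|p.[y]| * y + `|c|) * expR (- (a * y)))).
  rewrite ler_wpM2r ?expR_ge0//; apply: le_trans (ler_normD _ _) _.
  by rewrite normrM (ger0_norm y0).
rewrite mulrDl lerD//; last first.
  rewrite -[leRHS]mulr1 ler_wpM2l// -[leRHS]expR0 ler_expR oppr_le0.
  by rewrite mulr_ge0// ltW.
rewrite (_ : a * y = a / 2 * y + a / 2 * y); last by field.
rewrite opprD expRD mulrACA; apply: ler_pM; rewrite ?CP//.
  by rewrite mulr_ge0// expR_ge0.
rewrite expRN -[leRHS]mulr1 ler_pdivrMr ?expR_gt0// mulr1 mulrC ler_pdivlMr//.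
by rewrite mulrC (le_trans _ (expR_ge1Dx _))// lerDr.
Qed.

(** The functions p(1/t) exp(-1/t), extended by 0 to t <= 0. They form a class
that is stable under differentiation, and flat 1 is the usual smooth function
that vanishes exactly for t <= 0. *)
Definition flat p t : R := if 0 < t then p.[t^-1] * expR (- t^-1) else 0.

(** Differentiating p(1/t) exp(-1/t) produces (1/t)^2 (p - p')(1/t) exp(-1/t). *)
Definition flat_deriv p : {poly R} := 'X^2 * (p - p^`()).

(** The only delicate point is t = 0, where (1/t)^2 p(1/t) exp(-1/t) is bounded, so
that flat p h is O(h^2). *)
Lemma is_derive_flat p t : is_derive t 1 (flat p) (flat (flat_deriv p) t).
Proof.
have [t0|t0|->] := ltgtP t 0.
- have -> : flat (flat_deriv p) t = 0 by rewrite /flat ltNge (ltW t0).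
  apply: (@near_eq_is_derive _ _ _ (cst 0)).
  near=> s; rewrite /flat ltNge ifF//; apply/negbTE; rewrite negbK.
  by apply: ltW; near: s; exact: lt_nbhsl.
- have tn0 : t != 0 by rewrite gt_eqF.
  have -> : flat (flat_deriv p) t = (flat_deriv p).[t^-1] * expR (- t^-1).
    by rewrite /flat t0.
  apply: (@near_eq_is_derive _ _ _
     ((horner p \o GRing.inv) * (expR \o (- GRing.inv)))).
    near=> s; rewrite /flat ifT//.
    by near: s; apply: open_nbhs_nbhs; split => //; exact: open_gt.
  have dV : is_derive t 1 (@GRing.inv R) (- t ^- 2).
    by have := is_deriveV tn0 (is_derive_id t 1); rewrite [_ *: 1]mulr1.
  have d1 : is_derive t 1 (horner p \o GRing.inv) (p^`().[t^-1] * - t ^- 2).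
    exact: is_derive1_comp.
  have d2 : is_derive t 1 (expR \o (- GRing.inv)) (expR (- t^-1) * - - t ^- 2).
    exact: is_derive1_comp.
  apply: is_derive_eq (is_deriveM d1 d2) _.
  by rewrite /flat_deriv !hornerE/= /GRing.scale/=; field.
- have [C CP] := horner_expR_bounded ('X^2 * p) ltr01.
  have -> : flat (flat_deriv p) 0 = 0 by rewrite /flat ltxx.
  apply: (@is_derive1_sqr_bound _ _ C).
    by rewrite /flat ltxx.
  move=> h; rewrite /flat; case: ifPn => [h0|_]; last first.
    rewrite normr0 mulr_ge0 ?sqr_ge0//.
    by apply: le_trans (CP 0 _) => //; rewrite mulr_ge0 ?expR_ge0.
  have := CP h^-1; rewrite invr_ge0 ltW// mul1r => /(_ isT).
  rewrite hornerM hornerXn normrM (ger0_norm (sqr_ge0 _)) exprVn -mulrA mulrC.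
  by rewrite ler_pdivrMr ?exprn_gt0// normrM (ger0_norm (expR_ge0 _)).
Unshelve. all: by end_near. Qed.

Lemma flat_chain p : derivative_chain setT (fun j => flat (iter j flat_deriv p)).
Proof. by move=> j t _; exact: is_derive_flat. Qed.

Notation e := (flat 1).

Lemma flat1_gt0 t : 0 < t -> 0 < e t.
Proof. by move=> t0; rewrite /flat t0 hornerE mul1r expR_gt0. Qed.

Lemma flat_le0 p t : t <= 0 -> flat p t = 0.
Proof. by move=> t0; rewrite /flat ltNge t0. Qed.

Lemma flat1_ge0 t : 0 <= e t.
Proof. by have [/flat_le0 ->//|/flat1_gt0/ltW] := leP t 0. Qed.

Lemma flat1_le1 t : e t <= 1.
Proof.
have [/flat_le0 ->//|t0] := leP t 0.
rewrite /flat t0 hornerE mul1r -[leRHS]expR0 ler_expR oppr_le0 invr_ge0.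
exact: ltW.
Qed.

(** The coefficient (1/2) (1/2 - 1) ... (1/2 - (j - 1)) of the j-th derivative of
the square root. *)
Definition sqrt_deriv_coef (j : nat) : R := \prod_(k < j) (1 / 2 - k%:R).

Lemma sqrt_chain : derivative_chain [set t : R | 0 < t]
  (fun j t => sqrt_deriv_coef j * (Num.sqrt t * t ^- j)).
Proof.
move=> j t /= t0; have tn0 : t != 0 by rewrite gt_eqF.
have sq0 : Num.sqrt t != 0 by rewrite gt_eqF// sqrtr_gt0.
have dX : is_derive t 1 (fun s : R => (s ^+ j)^-1)
    (- (t ^+ j) ^- 2 *: (j%:R * t ^+ j.-1)).
  apply: is_deriveV; first by rewrite expf_neq0.
  apply: DeriveDef; first exact: exprn_derivable.
  by rewrite exp_derive [LHS]mulr1.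
have := is_deriveM (is_derive1_sqrt t0) dX => dM.
apply: is_derive_eq (is_deriveZ (sqrt_deriv_coef j) dM) _.
rewrite /sqrt_deriv_coef big_ord_recr/= /GRing.scale/= -mulrA; congr (_ * _).
have -> : (2 * Num.sqrt t)^-1 = Num.sqrt t / (2 * t).
  by rewrite -[X in _ / (_ * X)](sqr_sqrtr (ltW t0)); field.
case: j {dX dM} => [|j] /=; first by rewrite !expr0 expr1; field.
have tj : t ^+ j != 0 by rewrite expf_neq0.
by rewrite !exprS -natr1; field; rewrite tn0 tj.
Qed.

End flat_functions.

(** * Integration by parts *)

Section integration_by_parts.
Context {R : realType} {N : nat}.
Local Notation leb := (lebesgue_rV R N).
Implicit Types (f g u : 'rV[R]_N -> R) (Omega : set 'rV[R]_N).

Lemma compact_closed_eball (p : 'rV[R]_N) (r : R) :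
  compact [set x | enorm (x - p) <= r].
Proof.
apply: bounded_closed_compact.
  exists (r + `|p|); split; first exact: num_real.
  move=> C rC x /= xr; rewrite -[x](subrK p); apply: le_trans (ler_normD _ _) _.
  by apply: le_trans (ltW rC); rewrite lerD2r (le_trans (le_norm_enorm _)).
have cd : continuous (fun x : 'rV[R]_N => enorm (x - p)).
  apply: (@continuous_lipschitz _ _ (fun x : 'rV[R]_N => enorm (x - p)) 1) => // y z.
  by rewrite mul1r (le_trans (ler_enorm_dist _ _))// opprB addrA subrK.
have -> : [set x | enorm (x - p) <= r] =
  (fun x : 'rV[R]_N => enorm (x - p)) @^-1` [set y | y <= r] by [].
apply: preimage_closed; last exact: closed_le.
by move=> x _; exact: cd.
Qed.

(** Closed Euclidean balls are compact. *)
Lemma continuous_enorm_bounded u (M : R) : continuous u ->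
  exists2 C : R, 0 <= C & forall x, enorm x <= M -> `|u x| <= C.
Proof.
move=> cu; have cA := @compact_closed_eball 0 M.
set A := [set x | _] in cA.
have [A0|/set0P A0] := eqVneq A set0.
  exists 0 => // x xM; suff : A x by rewrite A0.
  by rewrite /A/= subr0.
have [|c _ cP] := @EVT_max_rV R N (fun x => `|u x|) A A0 cA.
  apply: continuous_subspaceT => x.
  exact: (cvg_norm (cu x)).
by exists `|u c| => // x xM; apply: cP; rewrite inE /A/= subr0.
Qed.

Lemma integrable_continuous_support f (M : R) : continuous f ->
  (forall x, M <= enorm x -> f x = 0) -> leb.-integrable setT (EFin \o f).
Proof.
move=> cf fM; have [C C0 CP] := continuous_enorm_bounded M cf.
apply: (integrable_bounded_support (C := C) _ _ fM).
  exact: measurable_fun_continuous.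
by move=> x; have [/CP//|/ltW/fM->] := leP (enorm x) M; rewrite normr0.
Qed.

Lemma Rintegral_vanish Omega f : (forall x, ~ Omega x -> f x = 0) ->
  \int[leb]_(x in Omega) f x = \int[leb]_x f x.
Proof.
move=> f0; rewrite Rintegral_mkcond; congr (Rintegral _ _ _).
apply/funext => x; rewrite patchE; case: ifPn => // /negP xO.
by rewrite f0// => Ox; apply: xO; rewrite inE.
Qed.

(** The integral of the translates of f in the direction i is constant in the
size of the translation; differentiate it at 0 under the integral sign. *)
Lemma Rintegral_partial_eq0 f (i : 'I_N) (M : R) :
  (forall x, derivable f x (delta_mx ord0 i)) -> continuous f ->
  continuous (partial i f) ->
  (forall x, M <= enorm x -> f x = 0) ->
  (forall x, M <= enorm x -> partial i f x = 0) ->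
  \int[leb]_x partial i f x = 0.
Proof.
move=> df cf cdf fM dfM; pose v : 'rV[R]_N := delta_mx ord0 i.
have intf := integrable_continuous_support cf fM.
have [C C0 CP] := continuous_enorm_bounded M cdf.
have dfC x : `|partial i f x| <= C.
  by have [/CP//|/ltW/dfM->] := leP (enorm x) M; rewrite normr0.
pose F (t : R) (y : 'rV[R]_N) := f (y + t *: v).
have dF t y : is_derive t (1 : R) (F ^~ y) (partial i f (y + t *: v)).
  by apply: is_derive_ray; apply: derivableP.
have cst t : \int[leb]_y F t y = \int[leb]_y f y.
  by have [_] := Rintegral_translate (t *: v) intf.
have dF0 y : partial1of2 F 0 y = partial i f y.
  by rewrite partial1of2E derive_val scale0r addr0.
(* contains the support of every translate by t v with |t| < 1 *)
pose B := eball (0 : 'rV[R]_N) (M + enorm v).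
have intG : leb.-integrable setT (EFin \o (fun y => C * \1_B y)).
  apply: (@integrable_bounded_support _ _ _ (M + enorm v) C).
  - apply: measurable_funM => //; apply: measurable_indic.
    by apply: open_measurable_rV; exact: open_eball.
  - move=> x; rewrite normrM (ger0_norm C0) ger0_norm// indicE ler_piMr//.
    by case: (_ \in _).
  - move=> x xM; rewrite indicE memNset ?mulr0//.
    by rewrite /B /eball/= subr0; apply/negP; rewrite -leNgt.
have I0 : (`]-1, 1[%classic : set R) 0 by rewrite /= in_itv/= ltrN10 ltr01.
have := @differentiation_under_integral R _ _ leb F setT measurableT 0 (-1) 1 I0
  _ _ (fun y => C * \1_B y) _ intG _.
rewrite (_ : (fun x' => _) = (fun=> \int[leb]_y f y)); last exact/funext/cst.
rewrite derive1E derive_cst => H.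
rewrite -[LHS](@eq_Rintegral _ _ _ _ _ _ (fun y => partial1of2 F 0 y)); last first.
  by move=> y _; rewrite dF0.
apply/esym/H => //.
- by move=> t _; have [] := Rintegral_translate (t *: v) intf.
- by move=> y; rewrite mulr_ge0// indicE ler0n.
- move=> t y; rewrite /= in_itv/= => /andP[t1 t2] _.
  rewrite partial1of2E (@derive_val _ _ _ _ _ _ _ (dF t y)).
  have [yM|yM] := ltP (enorm y) (M + enorm v).
    by rewrite indicE mem_set ?mulr1 ?dfC// /B /eball/= subr0.
  rewrite dfM ?normr0 ?mulr_ge0//.
  have : enorm y <= enorm (y + t *: v) + enorm (t *: v).
    by rewrite -{1}(addrK (t *: v) y) -(enormN (t *: v)) ler_enormD.
  have : enorm (t *: v) <= enorm v.
    by rewrite enormZ ler_piMl ?enorm_ge0// ltW// ltr_norml t1.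
  by move: yM; lra.
Qed.

Lemma supp_vanish f x : ~ supp f x -> f x = 0.
Proof.
by move=> nsx; apply/eqP; apply/negP => /negP fx; apply: nsx; exact: subset_closure.
Qed.

Lemma supp_partial_vanish f i x : ~ supp f x -> partial i f x = 0.
Proof.
move=> nsx; rewrite /partial (@near_eq_derive _ _ _ _ (cst 0)) ?derive_cst//.
have osf : open (~` supp f) by apply: closed_openC; exact: closed_closure.
apply: filterS (open_nbhs_nbhs (conj osf nsx)) => y.
exact: supp_vanish.
Qed.

Lemma compact_vanish (A : set 'rV[R]_N) f : compact A ->
  (forall x, ~ A x -> f x = 0) ->
  exists M, forall x, M <= enorm x -> f x = 0.
Proof.
move=> cA fA.
have [A0|/set0P A0] := eqVneq A set0.
  by exists 0 => x _; apply: fA; rewrite A0.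
have [|c _ cP] := @EVT_max_rV R N (@enorm R N) A A0 cA.
  by apply: continuous_subspaceT; exact: continuous_enorm.
exists (enorm c + 1) => x cx; apply: fA => Ax.
by have := cP x; rewrite inE => /(_ Ax); move: cx; lra.
Qed.

(** The product f g has compact support, so its partial derivatives have integral
zero. *)
Lemma test_function_parts Omega f g i :
  test_function Omega f -> test_function Omega g ->
  \int[leb]_(x in Omega) (f x * partial i g x) =
  - \int[leb]_(x in Omega) (partial i f x * g x).
Proof.
move=> [Cf cf sf] [Cg cg sg].
have [M fM] := compact_vanish cf (@supp_vanish f).
have [M' f'M] := compact_vanish cf (@supp_partial_vanish f i).
have Cf' : continuous (partial i f) by have [_ /(_ i) [_]] := Cf 1%N; case.
have Cg' : continuous (partial i g) by have [_ /(_ i) [_]] := Cg 1%N; case.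
have df x : derivable f x (delta_mx ord0 i) by have [_ /(_ i) [+ _]] := Cf 1%N.
have dg x : derivable g x (delta_mx ord0 i) by have [_ /(_ i) [+ _]] := Cg 1%N.
have cf0 : continuous f := is_Ck_continuous (Cf 0%N).
have cg0 : continuous g := is_Ck_continuous (Cg 0%N).
rewrite Rintegral_vanish; last first.
  by move=> x nx; rewrite supp_vanish ?mul0r// => /sf.
rewrite [in RHS]Rintegral_vanish; last first.
  by move=> x nx; rewrite supp_partial_vanish ?mul0r// => /sf.
pose m := Num.max M M'.
have m1 x : m <= enorm x -> f x = 0 by rewrite ge_max => /andP[/fM].
have m2 x : m <= enorm x -> partial i f x = 0 by rewrite ge_max => /andP[_ /f'M].
have pE : partial i (f * g) =
    (fun x => f x * partial i g x) \+ (fun x => partial i f x * g x).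
  by apply/funext => x; rewrite /partial deriveM//=; congr (_ + _); exact: mulrC.
have cont1 : continuous (fun x => f x * partial i g x).
  by move=> x; apply: continuousM; [exact: cf0|exact: Cg'].
have cont2 : continuous (fun x => partial i f x * g x).
  by move=> x; apply: continuousM; [exact: Cf'|exact: cg0].
have int1 := integrable_continuous_support cont1 (M := m).
have int2 := integrable_continuous_support cont2 (M := m).
apply/eqP; rewrite -addr_eq0 -RintegralD//; first last.
- by apply: int2 => x /m2 ->; rewrite mul0r.
- by apply: int1 => x /m1 ->; rewrite mul0r.
apply/eqP; rewrite -[RHS](@Rintegral_partial_eq0 (f * g) i m).
- by rewrite pE.
- by move=> x; exact: derivableM.
- by move=> x; apply: continuousM; [exact: cf0|exact: cg0].
- by rewrite pE => x; apply: continuousD; [exact: cont1|exact: cont2].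
- by move=> x /m1 fx; rewrite -[LHS]/(f x * g x) fx mul0r.
- by rewrite pE => x mx; rewrite /= m1// m2// !mul0r addr0.
Qed.

End integration_by_parts.

(** * Bumps *)

Section bumps.
Context {R : realType} {N : nat}.
Local Notation leb := (lebesgue_rV R N).
Implicit Types (f g u : 'rV[R]_N -> R) (Omega : set 'rV[R]_N) (p v x z : 'rV[R]_N).

Lemma sqr_enormD (w v : 'rV[R]_N) (h : R) : enorm (w + h *: v) ^+ 2 =
  enorm w ^+ 2 + (2 * \sum_i w ord0 i * v ord0 i) * h + enorm v ^+ 2 * h ^+ 2.
Proof.
rewrite !sqr_enorm mulr_sumr !mulr_suml -!big_split/=.
by apply: eq_bigr => i _; rewrite !mxE; ring.
Qed.

Lemma is_derive_quadratic (a b c : R) :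
  is_derive (0 : R) (1 : R) (fun h : R => a + b * h + c * h ^+ 2) b.
Proof.
have H := is_deriveD (is_deriveD (is_derive_cst a (0 : R) (1 : R))
  (is_deriveZ b (is_derive_id (0 : R) (1 : R)))) (is_deriveZ c (is_deriveM
  (is_derive_id (0 : R) (1 : R)) (is_derive_id (0 : R) (1 : R)))).
apply: is_derive_eq H _.
by rewrite !scale0r addr0 add0r scaler0 addr0 [_ *: 1]mulr1.
Qed.

Lemma is_derive_sqdist p z v : is_derive z v (fun y => enorm (y - p) ^+ 2)
  (2 * \sum_i (z - p) ord0 i * v ord0 i).
Proof.
apply/is_derive_line.
rewrite [X in is_derive _ _ X](_ : _ = (fun h => enorm (z - p) ^+ 2 +
  (2 * \sum_i (z - p) ord0 i * v ord0 i) * h + enorm v ^+ 2 * h ^+ 2)).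
  exact: is_derive_quadratic.
by apply/funext => h; rewrite -sqr_enormD; congr (enorm _ ^+ 2); rewrite [_ + z]addrC addrAC.
Qed.

Lemma is_Ck_sqdist k p : is_Ck k (fun y => enorm (y - p) ^+ 2).
Proof.
rewrite (_ : (fun y => _) = (fun y : 'rV[R]_N =>
    \sum_i ((fun y => y ord0 i) + cst (- p ord0 i)) y *
           ((fun y => y ord0 i) + cst (- p ord0 i)) y)).
  apply: (@is_Ck_sum _ _ k _ _ (fun i => ((fun y => y ord0 i) + cst (- p ord0 i)) *
           ((fun y => y ord0 i) + cst (- p ord0 i)))) => i.
  by apply: is_CkM; apply: is_CkD (is_Ck_coord _ _) (is_Ck_cst _ _).
apply/funext => y; rewrite sqr_enorm; apply: eq_bigr => i _.
by rewrite -[RHS]/((y ord0 i - p ord0 i) * (y ord0 i - p ord0 i)) !mxE expr2.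
Qed.

Lemma sum_delta (w : 'rV[R]_N) (i : 'I_N) :
  \sum_j w ord0 j * (delta_mx ord0 i : 'rV[R]_N) ord0 j = w ord0 i.
Proof.
rewrite (bigD1 i)//= !mxE !eqxx mulr1 big1 ?addr0// => j ji.
by rewrite !mxE eqxx (negbTE ji) mulr0.
Qed.

Lemma test_function_compact Omega f (A : set 'rV[R]_N) : compact A -> A `<=` Omega ->
  (forall k, is_Ck k f) -> (forall x, ~ A x -> f x = 0) -> test_function Omega f.
Proof.
move=> cA AO Cf fA.
have sA : supp f `<=` A.
  have /closure_id -> : closed A by apply: compact_closed cA; exact: norm_hausdorff.
  by apply: closureS => x /= fx; apply: contrapT => /fA f0; rewrite f0 eqxx in fx.
split => //; last exact: subset_trans sA AO.
apply: subclosed_compact cA sA; exact: closed_closure.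
Qed.

(** A smooth function supported in the closed ball of center p and radius r. It is
symmetric in p and z, so that derivatives in the center reduce to derivatives
in z. *)
Definition bump (p : 'rV[R]_N) (r : R) (z : 'rV[R]_N) : R :=
  flat 1 (r ^+ 2 - enorm (z - p) ^+ 2).

(** The direction-independent factor of the derivatives of the bump. *)
Definition bump_slope p (r : R) z : R :=
  flat (flat_deriv 1) (r ^+ 2 - enorm (z - p) ^+ 2).

Lemma bump_ge0 p r z : 0 <= bump p r z. Proof. exact: flat1_ge0. Qed.

Lemma bumpC p r z : bump p r z = bump z r p.
Proof. by rewrite /bump enormB. Qed.

Lemma is_Ck_bump k p r : is_Ck k (bump p r).
Proof.
have C1 : is_Ck k (fun z => r ^+ 2 - enorm (z - p) ^+ 2).
  rewrite (_ : (fun z => _) = cst (r ^+ 2) + (fun z => (-1) * enorm (z - p) ^+ 2)).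
    by apply: is_CkD; [exact: is_Ck_cst|apply: is_CkZ; exact: is_Ck_sqdist].
  by apply/funext => z; rewrite -[RHS]/(r ^+ 2 + (-1) * enorm (z - p) ^+ 2) mulN1r.
exact: (is_Ck_comp (@flat_chain R 1) (fun _ => I) C1 0).
Qed.

Lemma is_derive_bump p r z v : is_derive z v (bump p r)
  (bump_slope p r z * - (2 * \sum_i (z - p) ord0 i * v ord0 i)).
Proof.
apply: is_derive_comp; last exact: is_derive_flat.
rewrite -[X in is_derive _ _ _ X]add0r.
exact: (is_deriveD (is_derive_cst _ _ _) (is_deriveN (is_derive_sqdist _ _ _))).
Qed.

Lemma partial_bump p r i z :
  partial i (bump p r) z = bump_slope p r z * - (2 * (z - p) ord0 i).
Proof.
rewrite /partial (@derive_val _ _ _ _ _ _ _ (is_derive_bump p r z _)).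
by rewrite sum_delta.
Qed.

Lemma bump_arg_le0 p r z : 0 <= r -> r <= enorm (z - p) ->
  r ^+ 2 - enorm (z - p) ^+ 2 <= 0.
Proof.
by move=> r0 rz; rewrite subr_le0 lerXn2r ?nnegrE ?enorm_ge0.
Qed.

Lemma bump_vanish p r z : 0 <= r -> r <= enorm (z - p) -> bump p r z = 0.
Proof. by move=> r0 rz; rewrite /bump flat_le0 ?bump_arg_le0. Qed.

Lemma bump_slope_vanish p r z : 0 <= r -> r <= enorm (z - p) -> bump_slope p r z = 0.
Proof. by move=> r0 rz; rewrite /bump_slope flat_le0 ?bump_arg_le0. Qed.

Lemma bump_test_function Omega p r r' : 0 <= r -> r < r' -> eball p r' `<=` Omega ->
  test_function Omega (bump p r).
Proof.
move=> r0 rr' rO; apply: (test_function_compact (@compact_closed_eball _ _ p r)).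
- by move=> z /= zr; apply: rO; exact: le_lt_trans rr'.
- by move=> k; exact: is_Ck_bump.
- by move=> z /= /negP; rewrite -ltNge => /ltW; exact: bump_vanish.
Qed.

Lemma integrable_bump p r : 0 <= r -> leb.-integrable setT (EFin \o bump p r).
Proof.
move=> r0; apply: (@integrable_continuous_support _ _ _ (enorm p + r)).
  exact: is_Ck_continuous (is_Ck_bump 0 p r).
move=> z zr; apply: bump_vanish => //.
by have := ler_enormD (z - p) p; rewrite subrK; move: zr; lra.
Qed.

Lemma integral_bump_translate p r : 0 <= r ->
  \int[leb]_z bump p r z = \int[leb]_z bump 0 r z.
Proof.
move=> r0; have [_ <-] := Rintegral_translate (- p) (@integrable_bump 0 r r0).
by apply: eq_Rintegral => z _; rewrite /bump subr0.
Qed.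

(** If the integral vanished, the bump would vanish almost everywhere, but it is
positive on an open ball, which has positive measure. *)
Lemma integral_bump_gt0 p r : 0 < r -> 0 < \int[leb]_z bump p r z.
Proof.
move=> r0; rewrite lt_neqAle; apply/andP; split; last first.
  by apply: Rintegral_ge0 => z _; exact: bump_ge0.
apply/eqP => I0.
have intb := @integrable_bump p r (ltW r0).
have mb : measurable_fun setT (EFin \o bump p r) := measurable_int _ intb.
have : (\int[leb]_z `|(EFin \o bump p r) z| = 0)%E.
  under eq_integral do rewrite /= ger0_norm ?bump_ge0//.
  by rewrite -[LHS]fineK ?(integrable_fin_num _ intb)// -[X in X%:E]/(Rintegral _ _ _) -I0.
move=> /(ae_eq_integral_abs leb measurableT mb) ae0.
have mB : measurable (eball p r) by apply: open_measurable_rV; exact: open_eball.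
have : leb (eball p r) = 0%E.
  apply/(negligibleP leb mB); apply: negligibleS ae0 => z.
  rewrite /eball/= => zr /(_ I) [].
  apply/eqP; rewrite gt_eqF// flat1_gt0// subr_gt0.
  by rewrite ltrXn2r ?nnegrE ?enorm_ge0// ltW.
apply/eqP; rewrite gt_eqF// lebesgue_rV_open_gt0//; first exact: open_eball.
by exists p; exact: eball_center.
Qed.

End bumps.

(** * Testing a weak gradient against a bump *)

Section ae_dominated.
Context d (T : measurableType d) (R : realType) (mu : {measure set T -> \bar R}).

Lemma ae_dominated (D : set T) (f h : T -> R) : measurable D ->
  measurable_fun D f -> mu.-integrable D (EFin \o h) ->
  (forall x, D x -> 0 <= h x) ->
  {ae mu, forall x, D x -> `|f x| <= h x} ->
  mu.-integrable D (EFin \o f) /\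
  `|\int[mu]_(x in D) f x| <= \int[mu]_(x in D) h x.
Proof.
move=> mD mf ih h0 fh.
have mh := measurable_int _ ih.
have le1 : (\int[mu]_(x in D) `|(f x)%:E| <= \int[mu]_(x in D) (h x)%:E)%E.
  apply: ae_ge0_le_integral => //.
  by apply: measurableT_comp => //; exact/measurable_EFinP.
have intf : mu.-integrable D (EFin \o f).
  apply/integrableP; split; first exact/measurable_EFinP.
  apply: le_lt_trans le1 _.
  by have /fin_numPlt/andP[] := integrable_fin_num mD ih.
split => //; apply: le_trans (le_normr_Rintegral mD intf) _.
have if1 : (\int[mu]_(x in D) `|(f x)%:E|)%E \is a fin_num.
  by have := integrable_fin_num mD (integrable_abse intf).
have ih1 : (\int[mu]_(x in D) (h x)%:E)%E \is a fin_num.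
  by have := integrable_fin_num mD ih.
exact: fine_le if1 ih1 le1.
Qed.

Lemma Rintegral_sum (I : Type) (s : seq I) (D : set T) (F : I -> T -> R) :
  measurable D -> (forall i, mu.-integrable D (EFin \o F i)) ->
  mu.-integrable D (EFin \o (fun x => \sum_(i <- s) F i x)) /\
  \int[mu]_(x in D) (\sum_(i <- s) F i x) = \sum_(i <- s) \int[mu]_(x in D) F i x.
Proof.
move=> mD iF; elim: s => [|i s [IH1 IH2]].
  under eq_fun do rewrite big_nil; rewrite big_nil.
  split; first exact: (@integrable0 _ _ _ mu D).
  by rewrite Rintegral_cst ?mul0r.
rewrite big_cons -IH2 -RintegralD//.
have E : (fun x => \sum_(j <- i :: s) F j x) = (fun x => F i x + \sum_(j <- s) F j x).
  by apply/funext => x; rewrite big_cons.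
by rewrite E; split => //; exact: (integrableD mD (iF i) IH1).
Qed.

End ae_dominated.

Section local_lipschitz.
Context {R : realType} {N : nat}.
Local Notation leb := (lebesgue_rV R N).
Variables (Omega : set 'rV[R]_N) (u : 'rV[R]_N -> R) (G : 'rV[R]_N -> 'rV[R]_N).
Variable M : R.
Hypotheses (oOmega : open Omega) (cu : continuous u) (mG : measurable_fun Omega G)
  (uG : weak_gradient Omega u G) (M0 : 0 <= M)
  (GM : {ae leb, forall x, Omega x -> enorm (G x) <= M}).

(** By definition of the weak gradient the left-hand side is the integral of
(G . v) phi, and |G . v| <= M |v| almost everywhere. *)
Lemma weak_gradient_bound (v : 'rV[R]_N) phi : test_function Omega phi ->
  (forall x, 0 <= phi x) ->
  `|\sum_i v ord0 i * \int[leb]_(x in Omega) (u x * partial i phi x)|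
    <= M * enorm v * \int[leb]_x phi x.
Proof.
move=> tphi phi0; have [Cphi cphi sphi] := tphi.
have mO : measurable Omega := open_measurable_rV oOmega.
have [B phiB] := compact_vanish cphi (@supp_vanish _ _ phi).
have cphi0 : continuous phi := is_Ck_continuous (Cphi 0%N).
have iphiT := integrable_continuous_support cphi0 phiB.
have iphi : leb.-integrable Omega (EFin \o phi).
  exact: integrableS iphiT.
have mphi : measurable_fun Omega phi.
  by apply/measurable_EFinP; exact: measurable_int iphi.
have mGi i : measurable_fun Omega (fun x => G x ord0 i).
  exact: (measurableT_comp (measurable_coord i) mG).
have mGphi i : measurable_fun Omega (fun x => G x ord0 i * phi x).
  exact: measurable_funM.
have iphiZ a : leb.-integrable Omega (EFin \o (fun x => a * phi x)).
  by have := integrableZl mO a iphi.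
have iGphi i : leb.-integrable Omega (EFin \o (fun x => G x ord0 i * phi x)).
  apply: (ae_dominated mO (mGphi i) (iphiZ M) _ _).1.
  - by move=> x _; rewrite mulr_ge0.
  - apply: filterS GM => x GMx Ox; rewrite normrM (ger0_norm (phi0 x)) ler_wpM2r//.
    by rewrite (le_trans (le_coord_enorm _ _))// GMx.
have iZ i : leb.-integrable Omega (EFin \o (fun x => v ord0 i * (G x ord0 i * phi x))).
  by have := integrableZl mO (v ord0 i) (iGphi i).
have [isum Esum] := Rintegral_sum (index_enum 'I_N) mO iZ.
have -> : \sum_i v ord0 i * \int[leb]_(x in Omega) (u x * partial i phi x) =
    - \int[leb]_(x in Omega) (\sum_i v ord0 i * (G x ord0 i * phi x)).
  rewrite Esum -sumrN; apply: eq_bigr => i _.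
  by rewrite uG// mulrN RintegralZl.
rewrite normrN -[X in _ <= _ * X](Rintegral_vanish (Omega := Omega)); last first.
  by move=> x nO; rewrite supp_vanish// => /sphi.
rewrite -RintegralZl//; apply: (ae_dominated mO _ (iphiZ _) _ _).2.
- by apply/measurable_EFinP; exact: measurable_int isum.
- by move=> x _; rewrite !mulr_ge0// enorm_ge0.
- apply: filterS GM => x GMx Ox.
  rewrite (_ : \sum_i _ = (\sum_i v ord0 i * G x ord0 i) * phi x); last first.
    by rewrite mulr_suml; apply: eq_bigr => i _; rewrite mulrA.
  rewrite normrM (ger0_norm (phi0 x)) ler_wpM2r//.
  apply: le_trans (cauchy_schwarz _ _) _.
  by rewrite mulrC ler_wpM2r ?enorm_ge0// GMx.
Qed.

End local_lipschitz.

(** * Weak gradients bound increments along segments *)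

Section mollified_increment.
Context {R : realType} {N : nat}.
Local Notation leb := (lebesgue_rV R N).
Implicit Types (p v x z : 'rV[R]_N) (u : 'rV[R]_N -> R).

Lemma flat_bounded (q : {poly R}) : exists2 C : R, 0 <= C & forall t, `|flat q t| <= C.
Proof.
have [C CP] := horner_expR_bounded q ltr01.
have C0 : 0 <= C.
  by apply: le_trans (CP 0 _) => //; rewrite mulr_ge0 ?expR_ge0.
exists C => // t; rewrite /flat; case: ifPn => [t0|_]; last by rewrite normr0.
have := CP t^-1; rewrite invr_ge0 ltW// mul1r => /(_ isT).
by rewrite normrM (ger0_norm (expR_ge0 _)).
Qed.

(** Moving the center of the bump along v is the same as moving z along -v. *)
Lemma is_derive_bump_center x v (r t : R) z :
  is_derive t (1 : R) (fun s : R => bump (x + s *: v) r z)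
    (- \sum_i v ord0 i * partial i (bump (x + t *: v) r) z).
Proof.
rewrite (_ : (fun s : R => _) = (fun s : R => bump z r (x + s *: v))); last first.
  by apply/funext => s; rewrite bumpC.
apply: is_derive_ray; apply: is_derive_eq (is_derive_bump z r (x + t *: v) v) _.
rewrite {1}/bump_slope enormB -/(bump_slope (x + t *: v) r z).
rewrite mulr_sumr -!sumrN mulr_sumr; apply: eq_bigr => i _.
by rewrite partial_bump !mxE; ring.
Qed.

Lemma continuous_partial_bump i p (r : R) : continuous (partial i (bump p r)).
Proof. by have [_ /(_ i) [_ []]] := is_Ck_bump 1 p r. Qed.

Lemma partial_bump_vanish i p (r : R) z : 0 <= r -> r <= enorm (z - p) ->
  partial i (bump p r) z = 0.
Proof. by move=> r0 rz; rewrite partial_bump bump_slope_vanish ?mul0r. Qed.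

Lemma le_enorm_center p (r : R) z : enorm p + r <= enorm z -> r <= enorm (z - p).
Proof. by have := ler_enormD (z - p) p; rewrite subrK; lra. Qed.

(** Differentiation under the integral sign. Locally in t all the bumps are
supported in one ball, on which u is bounded, so a multiple of the indicator of
that ball dominates the derivatives. *)
Lemma is_derive_mollified u x v (r t : R) : continuous u -> 0 <= r -> -1 < t < 2 ->
  is_derive t (1 : R) (fun s : R => \int[leb]_z (u z * bump (x + s *: v) r z))
    (- \sum_i v ord0 i * \int[leb]_z (u z * partial i (bump (x + t *: v) r) z)).
Proof.
move=> cu r0 t12.
pose f (s : R) z := u z * bump (x + s *: v) r z.
have df s z : is_derive s (1 : R) (f ^~ z)
    (u z * (- \sum_i v ord0 i * partial i (bump (x + s *: v) r) z)).
  have := is_deriveZ (u z) (is_derive_bump_center x v r s z).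
  by rewrite /f.
have [Cq Cq0 CqP] := flat_bounded (flat_deriv 1).
(* for -1 < s < 2 the bump centered at x + s v is supported in the ball of radius
   B around 0 *)
pose B := enorm x + 2 * enorm v + r.
have [Cu Cu0 CuP] := continuous_enorm_bounded B cu.
pose K := Cu * (2 * Cq * (r * enorm v)).
have K0 : 0 <= K by rewrite !mulr_ge0// enorm_ge0.
have cB s z : -1 < s < 2 -> B <= enorm z -> r <= enorm (z - (x + s *: v)).
  move=> s12 Bz; apply: le_enorm_center; apply: le_trans Bz.
  rewrite lerD2r (le_trans (ler_enormD _ _))// lerD2l enormZ ler_wpM2r ?enorm_ge0//.
  by rewrite ler_norml; move: s12; lra.
have cf s : continuous (f s).
  move=> z; apply: continuousM; first exact: cu.
  by have := is_Ck_continuous (is_Ck_bump 0 (x + s *: v) r); apply.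
have int_f s : -1 < s < 2 -> leb.-integrable setT (EFin \o f s).
  move=> s12; apply: (@integrable_continuous_support _ _ _ B) => // z Bz.
  by rewrite /f bump_vanish ?mulr0//; exact: cB.
have iu i : leb.-integrable setT
    (EFin \o (fun z => u z * partial i (bump (x + t *: v) r) z)).
  apply: (@integrable_continuous_support _ _ _ B).
    by move=> z; apply: continuousM; [exact: cu|exact: continuous_partial_bump].
  by move=> z Bz; rewrite partial_bump_vanish ?mulr0//; exact: cB.
pose A := eball (0 : 'rV[R]_N) B.
pose H z := K * \1_A z.
have H0 z : 0 <= H z by rewrite mulr_ge0// indicE ler0n.
have iH : leb.-integrable setT (EFin \o H).
  apply: (@integrable_bounded_support _ _ _ B K).
  - apply: measurable_funM => //; apply: measurable_indic.
    by apply: open_measurable_rV; exact: open_eball.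
  - move=> z; rewrite normrM (ger0_norm K0) ger0_norm// indicE ler_piMr//.
    by case: (_ \in _).
  - move=> z zM; rewrite /H indicE memNset ?mulr0//.
    by rewrite /A /eball/= subr0; apply/negP; rewrite -leNgt.
have bound s z : -1 < s < 2 -> `|partial1of2 f s z| <= H z.
  move=> s12; rewrite partial1of2E (@derive_val _ _ _ _ _ _ _ (df s z)).
  have [zr|rz] := ltP (enorm (z - (x + s *: v))) r; last first.
    rewrite big1 ?oppr0 ?mulr0 ?normr0// => i _.
    by rewrite partial_bump_vanish// mulr0.
  have zB : enorm z < B.
    by rewrite ltNge; apply/negP => /(cB s z s12); rewrite leNgt zr.
  rewrite /H indicE mem_set ?mulr1; last by rewrite /A /eball/= subr0.
  rewrite normrM normrN /K; apply: ler_pM => //; first exact/CuP/ltW.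
  set w := z - (x + s *: v) in zr *.
  rewrite (_ : \sum_i _ = - (2 * bump_slope (x + s *: v) r z) *
      \sum_i w ord0 i * v ord0 i); last first.
    by rewrite mulr_sumr; apply: eq_bigr => i _; rewrite partial_bump; ring.
  rewrite normrM normrN normrM ger0_norm//; apply: ler_pM => //.
    by rewrite ler_wpM2l// CqP.
  apply: le_trans (cauchy_schwarz _ _) _.
  by rewrite ler_wpM2r ?enorm_ge0// ltW.
have It : (`]-1, 2[%classic : set R) t by rewrite /= in_itv.
have inI s : (`]-1, 2[%classic : set R) s -> -1 < s < 2 by rewrite /= in_itv.
have D1 := @derivable_under_integral R _ _ leb f setT measurableT t (-1) 2 It
  (fun s Is => int_f s (inI s Is)) (fun s z _ _ => @ex_derive _ _ _ _ _ _ _ (df s z))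
  H H0 iH (fun s z Is _ => bound s z (inI s Is)).
have D2 := @differentiation_under_integral R _ _ leb f setT measurableT t (-1) 2 It
  (fun s Is => int_f s (inI s Is)) (fun s z _ _ => @ex_derive _ _ _ _ _ _ _ (df s z))
  H H0 iH (fun s z Is _ => bound s z (inI s Is)).
apply: DeriveDef => //.
rewrite -derive1E D2.
have iZ i : leb.-integrable setT
    (EFin \o (fun z => - v ord0 i * (u z * partial i (bump (x + t *: v) r) z))).
  by have := integrableZl measurableT (- v ord0 i) (iu i).
have [_ Esum] := Rintegral_sum (index_enum 'I_N) measurableT iZ.
rewrite -sumrN [RHS](_ : _ = \sum_i \int[leb]_z
  (- v ord0 i * (u z * partial i (bump (x + t *: v) r) z))); last first.
  by apply: eq_bigr => i _; rewrite RintegralZl// mulNr.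
rewrite -Esum; apply: eq_Rintegral => z _.
rewrite partial1of2E (@derive_val _ _ _ _ _ _ _ (df t z)) -sumrN mulr_sumr.
by apply: eq_bigr => i _; ring.
Qed.

End mollified_increment.

Section lipschitz_segment.
Context {R : realType} {N : nat}.
Local Notation leb := (lebesgue_rV R N).
Variables (Omega : set 'rV[R]_N) (u : 'rV[R]_N -> R) (G : 'rV[R]_N -> 'rV[R]_N).
Variable M : R.
Hypotheses (oOmega : open Omega) (cu : continuous u) (mG : measurable_fun Omega G)
  (uG : weak_gradient Omega u G) (M0 : 0 <= M)
  (GM : {ae leb, forall x, Omega x -> enorm (G x) <= M}).

(** Along the segment the derivative of the mollified function is the expression
estimated in weak_gradient_bound; conclude by the mean value theorem. *)
Lemma mollified_lipschitz (x v : 'rV[R]_N) (r r' : R) : 0 < r -> r < r' ->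
  (forall t : R, 0 <= t <= 1 -> eball (x + t *: v) r' `<=` Omega) ->
  `|\int[leb]_z (u z * bump (x + v) r z) - \int[leb]_z (u z * bump x r z)|
   <= M * enorm v * \int[leb]_z bump 0 r z.
Proof.
move=> r0 rr' segO.
pose F (s : R) := \int[leb]_z (u z * bump (x + s *: v) r z).
pose F' (t : R) := - \sum_i v ord0 i *
  \int[leb]_z (u z * partial i (bump (x + t *: v) r) z).
have dF (t : R) : -1 < t < 2 -> is_derive t (1 : R) F (F' t).
  by move=> t12; apply: is_derive_mollified => //; exact: ltW.
have F'M (t : R) : 0 <= t <= 1 -> `|F' t| <= M * enorm v * \int[leb]_z bump 0 r z.
  move=> t01; have tb := bump_test_function (ltW r0) rr' (segO t t01).
  have [_ _ sb] := tb.
  rewrite /F' normrN -(@integral_bump_translate _ _ (x + t *: v) r (ltW r0)).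
  apply: le_trans (weak_gradient_bound oOmega mG uG M0 GM v tb _).
    rewrite le_eqVlt; apply/orP; left; apply/eqP; congr (`| _ |).
    apply: eq_bigr => i _; congr (_ * _); apply/esym/Rintegral_vanish => z nz.
    by rewrite supp_partial_vanish ?mulr0// => /sb.
  exact: bump_ge0.
have [||c c01 Fc] := @MVT R F F' 0 1 ltr01.
- by move=> t; rewrite in_itv/= => /andP[t0 t1]; apply: dF; lra.
- apply: derivable_within_continuous => t; rewrite in_itv/= => /andP[t0 t1].
  by have [] // := dF t _; lra.
have := F'M c; rewrite -[X in `|X|]mulr1 -[X in _ * X](subr0 (1 : R)) -Fc.
rewrite /F scale1r scale0r addr0; apply.
by move: c01; rewrite in_itv/= => /andP[/ltW-> /ltW->].
Qed.

(** On the support of the bump u differs from u x by at most e. *)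
Lemma mollified_close (x : 'rV[R]_N) (r e : R) : 0 < r ->
  (forall z, enorm (z - x) < r -> `|u z - u x| <= e) ->
  `|\int[leb]_z (u z * bump x r z) - u x * \int[leb]_z bump 0 r z|
    <= e * \int[leb]_z bump 0 r z.
Proof.
move=> r0 ue; rewrite -(@integral_bump_translate _ _ x r (ltW r0)).
have ib := @integrable_bump R N x r (ltW r0).
have cb : continuous (bump x r) := is_Ck_continuous (is_Ck_bump 0 x r).
have iub : leb.-integrable setT (EFin \o (fun z => u z * bump x r z)).
  apply: (@integrable_continuous_support _ _ _ (enorm x + r)).
    by move=> z; apply: continuousM; [exact: cu|exact: cb].
  by move=> z /le_enorm_center; move=> /(bump_vanish (ltW r0)) ->; rewrite mulr0.
have iZ a : leb.-integrable setT (EFin \o (fun z => a * bump x r z)).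
  by have := integrableZl measurableT a ib.
rewrite -!RintegralZl// -RintegralB//.
have iB : leb.-integrable setT (EFin \o (fun z => u z * bump x r z - u x * bump x r z)).
  by have := integrableB measurableT iub (iZ (u x)).
apply: (ae_dominated measurableT _ (iZ e) _ _).2.
- by apply/measurable_EFinP; exact: measurable_int iB.
- move=> z _; rewrite mulr_ge0 ?bump_ge0//.
  by apply: le_trans (ue x _); rewrite ?normr_ge0// subrr enorm0.
- apply: aeW => z _; rewrite -mulrBl normrM (ger0_norm (bump_ge0 _ _ _)).
  have [zr|rz] := ltP (enorm (z - x)) r; first by rewrite ler_wpM2r ?bump_ge0// ue.
  by rewrite bump_vanish ?mulr0// ltW.
Qed.

(** The inclusion of the tube in Omega makes the bumps that slide along the segment
test functions. Letting their radius tend to 0 recovers u at both ends. *)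
Lemma weak_gradient_lipschitz (x v : 'rV[R]_N) (r : R) : 0 < r ->
  (forall t : R, 0 <= t <= 1 -> eball (x + t *: v) r `<=` Omega) ->
  `|u (x + v) - u x| <= M * enorm v.
Proof.
move=> r0 segO; apply/ler_addgt0Pr => e e0.
have e2 : 0 < e / 2 by rewrite divr_gt0.
have close y : exists2 s, 0 < s & forall z, enorm (z - y) < s -> `|u z - u y| <= e / 2.
  have /(@cvgrPdist_le _ _ _ (nbhs y))/(_ _ e2) := @cu y.
  move=> /nbhs_eballP[s s0 sP]; exists s => // z zs.
  by rewrite distrC; exact: sP.
have [s1 s10 s1P] := close x.
have [s2 s20 s2P] := close (x + v).
pose s := Num.min (r / 2) (Num.min s1 s2).
have s0 : 0 < s by rewrite !lt_min s10 s20 divr_gt0.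
have sr : s < r.
  by rewrite gt_min; apply/orP; left; rewrite ltr_pdivrMr// mulr2n mulrDr mulr1 ltrDl.
have sP1 z : enorm (z - x) < s -> `|u z - u x| <= e / 2.
  by rewrite !lt_min => /and3P[_ zs1 _]; exact: s1P.
have sP2 z : enorm (z - (x + v)) < s -> `|u z - u (x + v)| <= e / 2.
  by rewrite !lt_min => /and3P[_ _ zs2]; exact: s2P.
have := mollified_lipschitz s0 sr segO.
have := mollified_close s0 sP1; have := mollified_close s0 sP2.
have := @integral_bump_gt0 R N 0 s s0.
set I := \int[leb]_z bump 0 s z; set I1 := \int[leb]_z _; set I2 := \int[leb]_z _.
move=> I0 h1 h2 h3; rewrite -(ler_pM2r I0) -[X in _ * X](gtr0_norm I0) -normrM.
(* the effect of sliding the bump, and the approximation errors at both ends *)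
rewrite (_ : _ * I = (I1 - I2) - (I1 - u (x + v) * I) + (I2 - u x * I)); last by ring.
apply: le_trans (ler_normD _ _) _; apply: le_trans (lerD (ler_normB _ _) h2) _.
by move: h1 h3; lra.
Qed.

End lipschitz_segment.

(** * Distance to the boundary *)

Section domain_geometry.
Context {R : realType} {n : nat}.
Implicit Types (Omega : set 'rV[R]_n.+1) (x y p v : 'rV[R]_n.+1).

Lemma bdry_notin Omega y : open Omega -> bdry Omega y -> ~ Omega y.
Proof. by move=> oO [_ nOy] Oy; apply: nOy; rewrite (interior_id _).1. Qed.

Lemma open_line_nbhs x v (t : R) (A : set 'rV[R]_n.+1) : open A -> A (x + t *: v) ->
  exists2 e : R, 0 < e & forall s, `|s - t| < e -> A (x + s *: v).
Proof.
move=> oA Ax; have /nbhs_eballP[r r0 rA] : nbhs (x + t *: v) A by exact: open_nbhs_nbhs.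
exists (r / (enorm v + 1)); first by rewrite divr_gt0// ltr_wpDl ?enorm_ge0.
move=> s; rewrite ltr_pdivlMr ?ltr_wpDl ?enorm_ge0// => st; apply: rA.
rewrite /eball/= opprD addrACA subrr add0r -scalerBl enormZ.
by apply: le_lt_trans st; rewrite ler_wpM2l// lerDl.
Qed.

(** The first parameter at which the segment from x to p leaves Omega gives a
boundary point. *)
Lemma segment_meets_bdry Omega x p : open Omega -> Omega x -> ~ Omega p ->
  exists2 y, bdry Omega y & enorm (x - y) <= enorm (x - p).
Proof.
move=> oO Ox nOp; pose v := p - x.
pose S := [set t : R | 0 <= t <= 1 /\ ~ Omega (x + t *: v)].
have S1 : S 1 by split; rewrite ?ler01 ?lexx// scale1r addrC subrK.
have lS : lbound S 0 by move=> t [/andP[]].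
have iS : has_inf S by split; [exists 1|exists 0].
pose s := inf S.
have s0 : 0 <= s by apply: lb_le_inf => //; exists 1.
have s1 : s <= 1 by apply: ge_inf => //; exists 0.
have nOs : ~ Omega (x + s *: v).
  move=> /(open_line_nbhs oO)[e e0 eP].
  have [t St ts] := inf_adherent e0 iS.
  have [_ []] := St; apply: eP.
  rewrite ger0_norm ?subr_ge0; last by apply: ge_inf => //; exists 0.
  by rewrite ltrBlDl.
have sn0 : s != 0.
  by apply/eqP => se; apply: nOs; rewrite se scale0r addr0.
have sp : 0 < s by rewrite lt_neqAle eq_sym sn0.
exists (x + s *: v); last first.
  rewrite opprD addNKr enormN enormZ ger0_norm// enormB.
  by rewrite ler_piMl ?enorm_ge0.
split; last by move=> /interior_subset.
move=> B; rewrite nbhsE => -[U [oU Us] UB].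
have [e e0 eP] := open_line_nbhs oU Us.
pose t := Num.max 0 (s - e / 2).
have ts : t < s by rewrite gt_max sp/= ltrBlDr ltrDl divr_gt0.
exists (x + t *: v); split; last first.
  apply/UB/eP; rewrite ler0_norm ?subr_le0 ?(ltW ts)// opprB.
  have : s - e / 2 <= t by rewrite le_max lexx orbT.
  by move: e0; lra.
apply: contrapT => nOt; have : s <= t.
  apply: ge_inf; first by exists 0.
  by split => //; rewrite le_max lexx/= (le_trans (ltW ts)).
by rewrite leNgt ts.
Qed.

Lemma bounded_enorm Omega : bounded_set Omega ->
  exists2 C : R, 0 < C & forall x, Omega x -> enorm x <= C.
Proof.
move=> /ex_strict_bound_gt0[C C0 CP]; exists (n.+1%:R * C); first by rewrite mulr_gt0.
move=> x Ox; apply: le_trans (le_enorm_norm x) _.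
by rewrite ler_wpM2l// ltW// CP.
Qed.

Lemma compact_bdry Omega : bounded_set Omega -> compact (bdry Omega).
Proof.
move=> /bounded_enorm[C C0 CP].
have cc := @compact_closed_eball R n.+1 0 C.
have clc := compact_closed (@norm_hausdorff _ _) cc.
apply: subclosed_compact cc _.
- apply: closedI; first exact: closed_closure.
  by apply: open_closedC; exact: open_interior.
- move=> y [yc _]; rewrite [X in X y](closure_id _).1//.
  by apply: closureS yc => x /CP; rewrite /= subr0.
Qed.

Lemma bdry_nonempty Omega : open Omega -> bounded_set Omega -> Omega !=set0 ->
  bdry Omega !=set0.
Proof.
move=> oO /bounded_enorm[C C0 CP] [x Ox].
pose p : 'rV[R]_n.+1 := const_mx (C + 1).
have nOp : ~ Omega p.
  move=> /CP; apply/negP; rewrite -ltNge.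
  apply: lt_le_trans (le_coord_enorm p ord0).
  by rewrite mxE gtr0_norm ?addr_gt0// ltrDl.
by have [y yb _] := segment_meets_bdry oO Ox nOp; exists y.
Qed.

Lemma dist_to_attained Omega x : open Omega -> bounded_set Omega -> Omega !=set0 ->
  exists2 y, bdry Omega y & dist_to x (bdry Omega) = enorm (x - y).
Proof.
move=> oO bO O0; have cb := compact_bdry bO; have b0 := bdry_nonempty oO bO O0.
have cd : continuous (fun y => enorm (x - y)).
  apply: (@continuous_lipschitz _ _ (fun y => enorm (x - y)) 1) => // y z.
  rewrite mul1r (le_trans (ler_enorm_dist _ _))//.
  by rewrite opprB addrC addrA subrK enormB.
have [|y yb yP] := @EVT_min_rV R _ (fun y => enorm (x - y)) _ b0 cb.
  exact: continuous_subspaceT.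
move: yb; rewrite inE => yb; exists y => //; apply/eqP; rewrite eq_le; apply/andP; split.
  apply: ge_inf; last by exists y.
  by exists 0 => _ [z _ <-]; exact: enorm_ge0.
apply: lb_le_inf; first by exists (enorm (x - y)), y.
by move=> _ [z zb <-]; apply: yP; rewrite inE.
Qed.

Lemma dist_to_le Omega x y : bdry Omega y -> dist_to x (bdry Omega) <= enorm (x - y).
Proof.
move=> yb; apply: ge_inf; last by exists y.
by exists 0 => _ [z _ <-]; exact: enorm_ge0.
Qed.

(** A point of the ball outside Omega would force a boundary point that is closer
than the distance. *)
Lemma dist_to_eball Omega x : open Omega -> Omega x ->
  eball x (dist_to x (bdry Omega)) `<=` Omega.
Proof.
move=> oO Ox p; rewrite /eball/= => px; apply: contrapT => nOp.
have [y yb] := segment_meets_bdry oO Ox nOp.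
rewrite leNgt => /negP; apply; rewrite enormB in px.
exact: lt_le_trans px (dist_to_le x yb).
Qed.

Lemma has_sup_dist_to Omega : open Omega -> bounded_set Omega -> Omega !=set0 ->
  has_sup [set dist_to x (bdry Omega) | x in closure Omega].
Proof.
move=> oO bO O0; have [y yb] := bdry_nonempty oO bO O0.
have [C C0 CP] := bounded_enorm bO.
split.
  have [x Ox] := O0; exists (dist_to x (bdry Omega)), x => //.
  exact: subset_closure.
exists (C + enorm y) => _ [x xc <-]; apply: le_trans (dist_to_le x yb) _.
apply: le_trans (ler_enormD _ _) _; rewrite enormN lerD2r.
have clc := compact_closed (@norm_hausdorff _ _) (@compact_closed_eball R n.+1 0 C).
have : closure [set z : 'rV[R]_n.+1 | enorm (z - 0) <= C] x.
  by apply: closureS xc => z /CP; rewrite /= subr0.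
by rewrite -(closure_id _).1//= subr0.
Qed.

Lemma dist_to_inradius Omega x : open Omega -> bounded_set Omega -> Omega x ->
  dist_to x (bdry Omega) <= inradius Omega.
Proof.
move=> oO bO Ox; have O0 : Omega !=set0 by exists x.
apply: ub_le_sup; last by exists x => //; exact: subset_closure.
by have [] := has_sup_dist_to oO bO O0.
Qed.

Lemma dist_to_gt0 Omega x : open Omega -> bounded_set Omega -> Omega x ->
  0 < dist_to x (bdry Omega).
Proof.
move=> oO bO Ox.
have [|y yb ->] := dist_to_attained x oO bO; first by exists x.
rewrite lt_neqAle enorm_ge0 andbT; apply/eqP => /esym/enorm_eq0/subr0_eq xy.
by apply: (bdry_notin oO yb); rewrite -xy.
Qed.

Lemma inradius_gt0 Omega : open Omega -> bounded_set Omega -> Omega !=set0 ->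
  0 < inradius Omega.
Proof.
move=> oO bO [x Ox].
exact: lt_le_trans (dist_to_gt0 oO bO Ox) (dist_to_inradius oO bO Ox).
Qed.

(** The supremum defining the inradius runs over the closure, but a point of the
closure at positive distance from the boundary lies in Omega. *)
Lemma inradius_adherent Omega (e : R) : open Omega -> bounded_set Omega -> Omega !=set0 ->
  0 < e -> e < inradius Omega ->
  exists x, eball x (inradius Omega - e) `<=` Omega.
Proof.
move=> oO bO O0 e0 eR.
have [_ [x xc <-] xe] := sup_adherent e0 (has_sup_dist_to oO bO O0).
exists x.
have Ox : Omega x.
  apply: contrapT => nOx.
  have xb : bdry Omega x by split => // /interior_subset.
  have := dist_to_le x xb; rewrite subrr enorm0.
  by move: xe; rewrite -/(inradius Omega); move: eR; lra.
move=> z; rewrite /eball/= => zx; apply: (dist_to_eball oO Ox).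
by rewrite /eball/=; exact: lt_trans xe.
Qed.

End domain_geometry.

(** * Pointwise bounds and norms *)

Section pointwise_bounds.
Context {R : realType} {n : nat}.
Local Notation leb := (lebesgue_rV R n.+1).
Implicit Types (Omega : set 'rV[R]_n.+1) (u J : 'rV[R]_n.+1 -> R).

(** Follow the segment towards the nearest boundary point y. It stays in the
inscribed ball except for its end point, so stop short of y by a fraction tau
of its length, where u is already small by continuity. *)
Lemma weak_gradient_dist_bound Omega u (G : 'rV[R]_n.+1 -> 'rV[R]_n.+1) (M : R) x :
  open Omega -> bounded_set Omega ->
  continuous u -> (forall y, ~ Omega y -> u y = 0) ->
  measurable_fun Omega G -> weak_gradient Omega u G -> 0 <= M ->
  {ae leb, forall y, Omega y -> enorm (G y) <= M} ->
  Omega x -> `|u x| <= M * dist_to x (bdry Omega).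
Proof.
move=> oO bO cu u0 mG uG M0 GM Ox.
have [|y yb dE] := dist_to_attained x oO bO; first by exists x.
have dO := dist_to_eball oO Ox.
have d0 := dist_to_gt0 oO bO Ox.
set d := dist_to x (bdry Omega) in dE dO d0 *.
apply/ler_addgt0Pr => e e0.
have /(@cvgrPdist_le _ _ _ (nbhs y))/(_ _ e0) := cu y.
move=> /nbhs_eballP[r r0 rP].
(* tau * d < r brings the stopping point within r of y, and tau <= 1 keeps it on
   the segment *)
pose tau := Num.min 1 (r / (2 * d)).
have tau0 : 0 < tau by rewrite lt_min ltr01 divr_gt0// mulr_gt0.
have tau1 : tau <= 1 by rewrite ge_min lexx.
have taur : tau * d < r.
  apply: (@le_lt_trans _ _ (r / 2)); last by move: r0; lra.
  rewrite -ler_pdivlMr// ge_min; apply/orP; right.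
  by rewrite invfM mulrA.
pose v := (1 - tau) *: (y - x).
have vE : enorm v = (1 - tau) * d.
  by rewrite /v enormZ ger0_norm ?subr_ge0// enormB dE.
have := @weak_gradient_lipschitz R n.+1 Omega u G M oO cu mG uG M0 GM x v (tau * d).
rewrite mulr_gt0// => /(_ isT) lip.
have {}lip : `|u (x + v) - u x| <= M * ((1 - tau) * d).
  rewrite -vE; apply: lip => t /andP[t0 t1] z; rewrite /eball/= => zt.
  apply: dO; rewrite /eball/=.
  have := ler_enormD (z - (x + t *: v)) (t *: v).
  rewrite opprD addrA subrK => /le_lt_trans; apply.
  have : enorm (t *: v) <= (1 - tau) * d.
    by rewrite enormZ vE ger0_norm// ler_piMl// mulr_ge0 ?subr_ge0// ltW.
  by move: zt; rewrite opprD addrA; lra.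
have uy : u y = 0 by apply: u0; exact: bdry_notin.
have : `|u y - u (x + v)| <= e.
  apply: rP; rewrite /eball/= /v (_ : _ - y = tau *: (x - y)).
    by rewrite enormZ gtr0_norm// -dE.
  by apply/rowP => i; rewrite !mxE; ring.
have : M * ((1 - tau) * d) <= M * d.
  apply: ler_wpM2l => //; apply: ler_piMl; first exact: ltW.
  by rewrite gerBl ltW.
move: lip; rewrite uy sub0r normrN.
have := ler_normB (u (x + v)) (u (x + v) - u x).
by rewrite opprB addrC subrK; lra.
Qed.

(** Each step moves x by the fraction 1/(m+1) of the way to y, which is at most r,
and what remains is at most m r. *)
Lemma jump_chain_bound u (B r : R) (m : nat) x y :
  (forall a b, enorm (a - b) <= r -> `|u a - u b| <= B) ->
  u y = 0 -> enorm (x - y) <= m%:R * r -> `|u x| <= m%:R * B.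
Proof.
move=> uB uy; elim: m x => [|m IH] x.
  rewrite !mul0r => xy.
  have /enorm_eq0/subr0_eq -> : enorm (x - y) = 0.
    by apply/eqP; rewrite eq_le xy enorm_ge0.
  by rewrite uy normr0.
move=> xy; pose w := m.+1%:R^-1 *: (y - x).
have m0 : 0 < m.+1%:R :> R by [].
have h1 : `|u x - u (x + w)| <= B.
  apply: uB; rewrite opprD addNKr enormN enormZ ger0_norm ?invr_ge0// enormB.
  by rewrite ler_pdivrMl.
have h2 : `|u (x + w)| <= m%:R * B.
  apply: IH.
  have -> : x + w - y = (m%:R / m.+1%:R) *: (x - y).
    by apply/rowP => i; rewrite !mxE; field; rewrite gt_eqF.
  rewrite enormZ ger0_norm ?divr_ge0// mulrAC ler_pdivrMr// -mulrA ler_wpM2l//.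
  by rewrite mulrC.
rewrite -[u x](subrK (u (x + w))); apply: le_trans (ler_normD _ _) _.
by rewrite -natr1 mulrDl mul1r [leRHS]addrC lerD.
Qed.

(** The boundary sphere belongs to the support because it is a limit of points
where J is positive. *)
Lemma kernel_supp J a : 0 < kernel_radius J ->
  (forall x, enorm x < kernel_radius J -> 0 < J x) ->
  supp J a <-> enorm a <= kernel_radius J.
Proof.
move=> r0 Jpos; set r := kernel_radius J in r0 Jpos *; split => ra.
- have clc := compact_closed (@norm_hausdorff _ _) (@compact_closed_eball R n.+1 0 r).
  suff : closure [set z : 'rV[R]_n.+1 | enorm (z - 0) <= r] a.
    by rewrite -(closure_id _).1//= subr0.
  apply: closureS ra => z /= Jz; rewrite subr0 leNgt; apply/negP => rz.
  have hS : has_inf [set s | 0 < s /\ forall x, ~ eball 0 s x -> J x = 0].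
    split; last by exists 0 => s [/ltW].
    apply/set0P/eqP => S0; move: r0.
    by rewrite /r /kernel_radius S0 inf0 ltxx.
  have rz' : 0 < enorm z - r by rewrite subr_gt0.
  have [s [s0 sP] sz] := inf_adherent rz' hS.
  move: Jz; rewrite sP ?eqxx// /eball/= subr0; apply/negP; rewrite -leNgt.
  by move: sz; rewrite -/(kernel_radius J) -/r; lra.
- move=> A; rewrite nbhsE => -[U [oU Ua] UA].
  have := @open_line_nbhs R n a (- a) 0 U oU; rewrite scale0r addr0 => /(_ Ua)[e e0 eP].
  pose t := Num.min 1 (e / 2).
  have t0 : 0 < t by rewrite lt_min ltr01 divr_gt0.
  have t1 : t <= 1 by rewrite ge_min lexx.
  exists (a + t *: - a); split; last first.
    apply/UA/eP; rewrite subr0 gtr0_norm//.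
    have : t <= e / 2 by rewrite ge_min lexx orbT.
    by move: e0; lra.
  rewrite /= gt_eqF// Jpos// scalerN -[a in a - _]scale1r -scalerBl enormZ.
  rewrite ger0_norm ?subr_ge0//.
  have [->|a0] := eqVneq (enorm a) 0; first by rewrite mulr0.
  apply: lt_le_trans ra; rewrite gtr_pMl; first by rewrite ltrBlDr ltrDl.
  by rewrite lt_neqAle eq_sym a0 enorm_ge0.
Qed.

Lemma jump_seminorm_ub J u (C : R) a b : (forall x, `|u x| <= C) ->
  supp J (a - b) -> `|u a - u b| <= jump_seminorm J u.
Proof.
move=> uC Jab; apply: ub_le_sup; last by exists (a, b).
exists (C + C) => _ [z _ <-]; apply: le_trans (ler_normB _ _) _.
exact: lerD.
Qed.

Lemma jump_seminorm_le J u (C : R) : 0 <= C ->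
  (forall a b, supp J (a - b) -> `|u a - u b| <= C) -> jump_seminorm J u <= C.
Proof.
move=> C0 uC.
have [S0|/set0P S0] := eqVneq
  [set `|u z.1 - u z.2| | z in [set z | supp J (z.1 - z.2)]] set0.
  by rewrite /jump_seminorm S0 sup0.
by apply: ge_sup => // _ [z Jz <-]; exact: uC.
Qed.

End pointwise_bounds.

Section norms.
Context {R : realType} {n : nat}.
Local Notation leb := (lebesgue_rV R n.+1).
Implicit Types (Omega : set 'rV[R]_n.+1) (f : 'rV[R]_n.+1 -> R).

(** The norm has a separate value on spaces of measure zero; the whole space has
positive measure. *)
Lemma Lp_norm_ooE Omega f :
  Lp_norm Omega +oo%E f = ess_sup leb (fun x => `|(f \_ Omega) x|%:E).
Proof.
rewrite /Lp_norm unlock ifT//; apply: lebesgue_rV_open_gt0; first exact: openT.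
by exists 0.
Qed.

Lemma Lp_norm_oo_le Omega f (C : R) : 0 <= C ->
  (forall x, Omega x -> `|f x| <= C) -> (Lp_norm Omega +oo%E f <= C%:E)%E.
Proof.
move=> C0 fC; rewrite Lp_norm_ooE; apply/ess_supP; apply: aeW => x.
rewrite lee_fin patchE; case: ifPn => [|_]; last by rewrite normr0.
by rewrite inE => /fC.
Qed.

Lemma Lp_norm_oo_ae Omega f : (Lp_norm Omega +oo%E f < +oo)%E ->
  {ae leb, forall x, Omega x -> `|f x| <= fine (Lp_norm Omega +oo%E f)}.
Proof.
move=> foo; have := ess_sup_ge leb (fun x => `|(f \_ Omega) x|%:E).
rewrite -Lp_norm_ooE; apply: filterS => x fx Ox.
rewrite -lee_fin fineK; last by rewrite ge0_fin_numE// /Lp_norm Lnorm_ge0.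
by move: fx; rewrite patchE mem_set.
Qed.

(** For a continuous function the essential supremum is a supremum, as nonempty
open sets have positive measure. *)
Lemma Lp_norm_oo_ge Omega f (c : R) x : open Omega -> continuous f -> Omega x ->
  c < `|f x| -> (c%:E <= Lp_norm Omega +oo%E f)%E.
Proof.
move=> oO cf Ox cfx; rewrite leNgt; apply/negP => fc.
pose A := Omega `&` [set y | c < `|f y|].
have oA : open A.
  apply: openI => //.
  rewrite (_ : [set y | _] = (fun y => `|f y|) @^-1` [set t | c < t])//.
  apply: open_comp; last exact: open_gt.
  by move=> y _; exact: (cvg_norm (cf y)).
have : (0 < leb A)%E by apply: lebesgue_rV_open_gt0 => //; exists x.
apply/negP; rewrite -leNgt le_eqVlt; apply/orP; left; apply/eqP.
apply/(negligibleP leb (open_measurable_rV oA)).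
have := ess_sup_ge leb (fun x => `|(f \_ Omega) x|%:E).
rewrite -Lp_norm_ooE; apply: negligibleS => y [Oy cy] /=.
rewrite patchE mem_set// => /le_lt_trans/(_ fc).
by rewrite lte_fin ltNge (ltW cy).
Qed.

Lemma fine_Lp_norm_ge0 Omega p f : 0 <= fine (Lp_norm Omega p f).
Proof. by rewrite fine_ge0// /Lp_norm Lnorm_ge0. Qed.

End norms.

(** * Test functions as Sobolev functions, and the smoothed cone *)

Section test_function_sobolev.
Context {R : realType} {n : nat}.
Local Notation leb := (lebesgue_rV R n.+1).
Implicit Types (Omega : set 'rV[R]_n.+1) (f phi : 'rV[R]_n.+1 -> R).

(** The constant sequence phi approximates phi, so only integrability and
integration by parts are at stake. *)
Lemma test_function_W1oo0 Omega phi : open Omega -> test_function Omega phi ->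
  W1oo0 Omega phi (grad phi).
Proof.
move=> oO tphi; have [Cphi cphi sphi] := tphi.
have mO : measurable Omega := open_measurable_rV oO.
have cphi0 : continuous phi := is_Ck_continuous (Cphi 0%N).
have cpart i : continuous (partial i phi).
  by have [_ /(_ i) [_ []]] := Cphi 1%N.
have cgrad : continuous (fun x => enorm (grad phi x)).
  have C0 i : is_Ck 0 (partial i phi) by split => //; exact: cpart.
  have [c2 _] := is_Ck_sum (index_enum 'I_n.+1) (fun i => is_CkM (C0 i) (C0 i)).
  move=> x; apply: (@continuous_comp _ _ _ (fun x => \sum_i (grad phi x) ord0 i ^+ 2)
     (@Num.sqrt R)); last exact: sqrt_continuous.
  rewrite (_ : (fun x => _) = (fun x => \sum_i (partial i phi * partial i phi) x)).
    exact: c2.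
  by apply/funext => y; apply: eq_bigr => i _; rewrite mxE expr2.
have phi0 x : ~ Omega x -> phi x = 0.
  by move=> nO; apply: supp_vanish => /sphi.
have grad0 x : ~ supp phi x -> enorm (grad phi x) = 0.
  move=> nS; rewrite (_ : grad phi x = 0) ?enorm0//.
  by apply/rowP => i; rewrite !mxE supp_partial_vanish.
have mgrad : measurable_fun Omega (grad phi).
  apply: measurable_funTS; apply: measurable_fun_rV => i.
  rewrite (_ : (fun x => _) = partial i phi); last by apply/funext => x; rewrite mxE.
  exact: measurable_fun_continuous.
have Lp_fin p f : p = +oo%E \/ p = 1%E -> continuous f ->
    (forall x, ~ supp phi x -> f x = 0) -> (Lp_norm Omega p f < +oo)%E.
  move=> pE cf f0; have [M fM] := compact_vanish cphi f0.
  case: pE => ->.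
    have [C C0 CP] := continuous_enorm_bounded M cf.
    apply: le_lt_trans (ltry C); apply: Lp_norm_oo_le => // x _.
    by have [/CP//|/ltW/fM->] := leP (enorm x) M; rewrite normr0.
  rewrite /Lp_norm Lnorm1.
  have intf := integrable_continuous_support cf fM.
  have -> : f \_ Omega = f.
    apply/funext => x; rewrite patchE; case: ifPn => // /negP xO.
    by rewrite f0// => /sphi Ox; apply: xO; rewrite inE.
  by have /integrableP[] := intf.
have wg : weak_gradient Omega phi (grad phi).
  move=> psi tpsi i; rewrite (test_function_parts i tphi tpsi); congr (- _).
  by apply: eq_Rintegral => x _; rewrite mxE.
have W1p p : p = +oo%E \/ p = 1%E -> W1 Omega p phi (grad phi).
  move=> pE; split => //.
  - by apply: measurable_funTS; exact: measurable_fun_continuous.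
  - by apply: Lp_fin => // x; exact: supp_vanish.
  - exact: Lp_fin.
split => //; first by apply: W1p; left.
split; first by apply: W1p; right.
have L0 : Lp_norm Omega 1%E (cst 0) = 0%E.
  rewrite /Lp_norm Lnorm1 integral0_eq// => x _ /=.
  by rewrite patchE; case: ifP; rewrite /= normr0.
exists (fun _ => phi); split => //.
- rewrite (_ : (fun k => _) = cst 0%E); first exact: cvg_cst.
  apply/funext => k; rewrite -[RHS]L0; congr (Lp_norm _ _ _).
  by apply/funext => x; rewrite subrr.
- rewrite (_ : (fun k => _) = cst 0%E); first exact: cvg_cst.
  apply/funext => k; rewrite -[RHS]L0; congr (Lp_norm _ _ _).
  by apply/funext => x; rewrite subrr enorm0.
Qed.

End test_function_sobolev.

Section smoothed_cone.
Context {R : realType} {n : nat}.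
Implicit Types (Omega : set 'rV[R]_n.+1).
Variable delta : R.
Hypothesis delta0 : 0 < delta.

(** A smooth approximation of the positive part, t exp(-delta/t) for t > 0. It is
chosen because its derivative stays in [0, 1], so that composing with it does
not increase slopes, and because it loses at most delta in height. *)
Definition smooth_pos (t : R) : R := t * flat 1 (t / delta).

Definition smooth_pos_deriv (t : R) : R :=
  flat 1 (t / delta) + t * (flat (flat_deriv 1) (t / delta) / delta).

Lemma is_derive_smooth_pos t : is_derive t (1 : R) smooth_pos (smooth_pos_deriv t).
Proof.
have d1 : is_derive t (1 : R) (fun s : R => delta^-1 * s) delta^-1.
  apply: is_derive_eq (is_deriveZ delta^-1 (is_derive_id t (1 : R))) _.
  by rewrite [LHS]mulr1.
have d2 : is_derive t (1 : R) (fun s => flat 1 (s / delta))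
    (flat (flat_deriv 1) (t / delta) / delta).
  rewrite (_ : (fun s => _) = flat 1 \o (fun s : R => delta^-1 * s)); last first.
    by apply/funext => s; rewrite /= mulrC.
  by rewrite [t / delta]mulrC; apply: is_derive1_comp; exact: is_derive_flat.
apply: is_derive_eq (is_deriveM (is_derive_id t (1 : R)) d2) _.
by rewrite addrC [_ *: 1]mulr1.
Qed.

Lemma smooth_pos_le0 t : t <= 0 -> smooth_pos t = 0.
Proof.
by move=> t0; rewrite /smooth_pos flat_le0 ?mulr0// pmulr_lle0 ?invr_gt0.
Qed.

(** With y = delta/t the derivative is exp(-y) (1 + y), and 1 + y <= exp y. *)
Lemma smooth_pos_deriv_itv t : 0 <= smooth_pos_deriv t <= 1.
Proof.
rewrite /smooth_pos_deriv; have [t0|t0] := leP t 0.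
  by rewrite !flat_le0 ?pmulr_lle0 ?invr_gt0// mul0r mulr0 addr0 lexx ler01.
have td : 0 < t / delta by rewrite divr_gt0.
rewrite /flat td /flat_deriv -polyC1 derivC subr0 !hornerE/=.
set y := (t / delta)^-1.
have y0 : 0 < y by rewrite invr_gt0.
rewrite [X in _ <= X <= _](_ : _ = expR (- y) * (1 + y)); last first.
  by rewrite /y; field; rewrite !gt_eqF.
rewrite mulr_ge0 ?expR_ge0 ?addr_ge0 ?(ltW y0)//= expRN.
by rewrite mulrC ler_pdivrMr ?expR_gt0// mul1r expR_ge1Dx.
Qed.

Lemma smooth_pos_lipschitz s t : `|smooth_pos s - smooth_pos t| <= `|s - t|.
Proof.
wlog st : s t / t <= s.
  move=> H; have [/H//|/ltW/H] := leP t s.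
  by rewrite distrC (distrC t).
have := @MVT_segment R smooth_pos smooth_pos_deriv t s st
  (fun x _ => is_derive_smooth_pos x).
case=> [|c _ ->].
  by apply: derivable_within_continuous => x _; have [] := is_derive_smooth_pos x.
have /andP[c0 c1] := smooth_pos_deriv_itv c.
by rewrite normrM ler_piMl// ger0_norm.
Qed.

Lemma smooth_pos_ge0 t : 0 <= smooth_pos t.
Proof.
have [/smooth_pos_le0->//|t0] := leP t 0.
by rewrite mulr_ge0 ?flat1_ge0// ltW.
Qed.

Lemma smooth_pos_ge t : t - delta <= smooth_pos t.
Proof.
have [t0|t0] := leP t 0; first by rewrite smooth_pos_le0//; move: delta0 t0; lra.
have td : 0 < t / delta by rewrite divr_gt0.
rewrite /smooth_pos /flat td -polyC1 hornerC mul1r.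
apply: (@le_trans _ _ (t * (1 - (t / delta)^-1))).
  by rewrite le_eqVlt; apply/orP; left; apply/eqP; field; rewrite !gt_eqF.
by rewrite ler_wpM2l ?(ltW t0)// expR_ge1Dx.
Qed.

Lemma smooth_pos_le t : 0 <= t -> smooth_pos t <= t.
Proof. by move=> t0; rewrite ler_piMr// flat1_le1. Qed.

Variables (x0 : 'rV[R]_n.+1) (r : R).
Hypothesis r0 : 0 < r.

(** The distance to x0, smoothed at x0. It is still 1-Lipschitz and dominates the
distance. *)
Definition smooth_dist (x : 'rV[R]_n.+1) : R :=
  Num.sqrt (delta ^+ 2 + enorm (x - x0) ^+ 2).

(** The cone of height r over the ball of radius r around x0, smoothed at its
apex and at its rim. *)
Definition cone (x : 'rV[R]_n.+1) : R := smooth_pos (r - smooth_dist x).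

Lemma smooth_dist_arg_gt0 x : 0 < delta ^+ 2 + enorm (x - x0) ^+ 2.
Proof. by rewrite ltr_wpDr ?sqr_ge0// exprn_gt0. Qed.

Lemma sqr_smooth_dist x : smooth_dist x ^+ 2 = delta ^+ 2 + enorm (x - x0) ^+ 2.
Proof. by rewrite /smooth_dist sqr_sqrtr// ltW// smooth_dist_arg_gt0. Qed.

Lemma smooth_dist_gt0 x : 0 < smooth_dist x.
Proof. by rewrite sqrtr_gt0 smooth_dist_arg_gt0. Qed.

Lemma enorm_le_smooth_dist x : enorm (x - x0) <= smooth_dist x.
Proof.
rewrite -[leLHS]ger0_norm ?enorm_ge0// -sqrtr_sqr ler_wsqrtr// lerDr.
exact: sqr_ge0.
Qed.

Lemma smooth_dist_lipschitz x y : `|smooth_dist x - smooth_dist y| <= enorm (x - y).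
Proof.
have h a b : smooth_dist a - smooth_dist b <= enorm (a - b).
  rewrite lerBlDr -ler_sqr ?nnegrE ?addr_ge0 ?enorm_ge0 ?sqrtr_ge0//.
  rewrite sqrrD !sqr_smooth_dist.
  have ab : enorm (a - x0) <= enorm (a - b) + enorm (b - x0).
    by rewrite (le_trans _ (ler_enormD _ _))// addrA subrK.
  have := enorm_le_smooth_dist b; have := enorm_ge0 (a - b); have := enorm_ge0 (a - x0).
  have := enorm_ge0 (b - x0).
  set A := enorm (a - x0) in ab *; set B := enorm (b - x0) in ab *.
  set D := enorm (a - b) in ab *; set H := smooth_dist b => B0 A0 D0 BH.
  have : A ^+ 2 <= (D + B) ^+ 2 by rewrite ler_sqr ?nnegrE ?addr_ge0.
  have : D * B <= D * H by rewrite ler_wpM2l.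
  by rewrite sqrrD !mulr2n; lra.
by rewrite ler_norml lerNl opprB [in X in X && _]enormB !h.
Qed.

Lemma is_Ck_smooth_dist k : is_Ck k smooth_dist.
Proof.
have C1 : is_Ck k (fun x => delta ^+ 2 + enorm (x - x0) ^+ 2).
  exact: (is_CkD (is_Ck_cst k (delta ^+ 2)) (is_Ck_sqdist k x0)).
have := is_Ck_comp (@sqrt_chain R) smooth_dist_arg_gt0 C1 0%N.
congr is_Ck; apply/funext => x.
by rewrite /= /sqrt_deriv_coef big_ord0 expr0 invr1 mulr1 mul1r.
Qed.

Lemma is_Ck_cone k : is_Ck k cone.
Proof.
have Cw : is_Ck k (fun x => r - smooth_dist x).
  rewrite (_ : (fun x => _) = cst r + (fun x => (-1) * smooth_dist x)).
    exact: is_CkD (is_Ck_cst k r) (is_CkZ (-1) (is_Ck_smooth_dist k)).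
  by apply/funext => x; rewrite -[RHS]/(r + (-1) * smooth_dist x) mulN1r.
have Cwd : is_Ck k (fun x => delta^-1 * (r - smooth_dist x)) by exact: is_CkZ.
have Ce := is_Ck_comp (@flat_chain R 1) (fun _ => I) Cwd 0%N.
have := is_CkM Cw Ce; congr is_Ck; apply/funext => x.
by rewrite /cone /smooth_pos [_ / delta]mulrC.
Qed.

Lemma is_derive_smooth_dist x v : is_derive x v smooth_dist
  ((\sum_i (x - x0) ord0 i * v ord0 i) / smooth_dist x).
Proof.
have d1 : is_derive x v (fun y => delta ^+ 2 + enorm (y - x0) ^+ 2)
    (2 * \sum_i (x - x0) ord0 i * v ord0 i).
  rewrite -[X in is_derive _ _ _ X]add0r.
  exact: (is_deriveD (is_derive_cst _ _ _) (is_derive_sqdist _ _ _)).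
apply: is_derive_eq (is_derive_comp d1 (is_derive1_sqrt (smooth_dist_arg_gt0 x))) _.
by rewrite -/(smooth_dist x); field; rewrite gt_eqF ?smooth_dist_gt0.
Qed.

(** The gradient is radial; its length is a product of two factors at most 1. *)
Lemma grad_cone x : grad cone x =
  (- (smooth_pos_deriv (r - smooth_dist x) / smooth_dist x)) *: (x - x0).
Proof.
apply/rowP => i; rewrite !mxE /partial.
have d1 : is_derive x (delta_mx ord0 i : 'rV[R]_n.+1) (fun y => r - smooth_dist y)
    (- ((\sum_j (x - x0) ord0 j * (delta_mx ord0 i : 'rV[R]_n.+1) ord0 j) / smooth_dist x)).
  rewrite -[X in is_derive _ _ _ X]add0r.
  exact: (is_deriveD (is_derive_cst _ _ _) (is_deriveN (is_derive_smooth_dist _ _))).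
rewrite (@derive_val _ _ _ _ _ _ _
  (is_derive_comp d1 (is_derive_smooth_pos (r - smooth_dist x)))) sum_delta !mxE.
by ring.
Qed.

Lemma enorm_grad_cone x : enorm (grad cone x) <= 1.
Proof.
have /andP[s0 s1] := smooth_pos_deriv_itv (r - smooth_dist x).
rewrite grad_cone enormZ normrN ger0_norm ?divr_ge0 ?(ltW (smooth_dist_gt0 x))//.
rewrite mulrAC ler_pdivrMr ?smooth_dist_gt0// mul1r.
apply: le_trans (enorm_le_smooth_dist x); rewrite ler_piMl ?enorm_ge0//.
Qed.

Lemma cone_lipschitz x y : `|cone x - cone y| <= enorm (x - y).
Proof.
apply: le_trans (smooth_pos_lipschitz _ _) _.
by rewrite opprB addrC addrA subrK distrC smooth_dist_lipschitz.
Qed.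

Lemma cone_itv x : 0 <= cone x <= r.
Proof.
rewrite /cone smooth_pos_ge0/=.
have [/smooth_pos_le0->|h] := leP (r - smooth_dist x) 0; first exact: ltW.
by apply: le_trans (smooth_pos_le (ltW h)) _; rewrite gerBl ltW// smooth_dist_gt0.
Qed.

Lemma cone_center : r - 2 * delta <= cone x0.
Proof.
apply: le_trans (smooth_pos_ge _).
by rewrite /smooth_dist subrr enorm0 expr0n addr0 sqrtr_sqr gtr0_norm//; lra.
Qed.

Lemma cone_test_function Omega r' : r < r' -> eball x0 r' `<=` Omega ->
  test_function Omega cone.
Proof.
move=> rr' rO; apply: (test_function_compact (@compact_closed_eball _ _ x0 r)).
- by move=> z /= zr; apply: rO; exact: le_lt_trans rr'.
- by move=> k; exact: is_Ck_cone.
- move=> z /= /negP; rewrite -ltNge => /ltW zr; apply: smooth_pos_le0.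
  by rewrite subr_le0 (le_trans zr)// enorm_le_smooth_dist.
Qed.

End smoothed_cone.

(** * The two bounds on Lambda *)

Section eigenvalue_bounds.
Context {R : realType} {n : nat}.
Local Notation leb := (lebesgue_rV R n.+1).
Variables (Omega : set 'rV[R]_n.+1) (J : 'rV[R]_n.+1 -> R).
Hypotheses (Omega0 : Omega !=set0) (oOmega : open Omega) (bOmega : bounded_set Omega).
Hypotheses (rJ0 : 0 < kernel_radius J)
  (Jpos : forall x, enorm x < kernel_radius J -> 0 < J x).

Let rad := inradius Omega.
Let quotients := [set q | exists u G,
    [/\ W1oo0 Omega u G, exists x, u x != 0 &
        q = Num.max (fine (Lp_norm Omega +oo (fun x => enorm (G x))))
                    (jump_seminorm J u)
            / fine (Lp_norm Omega +oo u)]].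

(** The supremum of |u| is at most rad * A by the gradient and at most m * B by the
jumps; it is positive because u is continuous and not zero. *)
Lemma quotient_lower_bound (m : nat) q : (0 < m)%N ->
  rad <= m%:R * kernel_radius J -> quotients q ->
  Num.max (1 / rad) (1 / m%:R) <= q.
Proof.
move=> m0 radm [u [G [uG [x1 ux1] ->]]].
have [cu u0 [mu uoo mG Goo wG] _] := uG.
set A := fine (Lp_norm _ _ (fun x => enorm (G x))); set B := jump_seminorm J u.
set U := fine _.
have rad0 : 0 < rad := inradius_gt0 oOmega bOmega Omega0.
have A0 : 0 <= A := fine_Lp_norm_ge0 _ _ _.
have GA : {ae leb, forall y, Omega y -> enorm (G y) <= A}.
  apply: filterS (Lp_norm_oo_ae Goo) => y GyA Oy.
  by have := GyA Oy; rewrite ger0_norm ?enorm_ge0.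
have uA x : `|u x| <= rad * A.
  have [Ox|/u0->] := pselect (Omega x); last by rewrite normr0 mulr_ge0// ltW.
  rewrite mulrC; apply: le_trans
    (weak_gradient_dist_bound oOmega bOmega cu u0 mG wG A0 GA Ox) _.
  by rewrite ler_wpM2l// dist_to_inradius.
have B0 : 0 <= B.
  have /(jump_seminorm_ub uA) : supp J (0 - 0).
    by apply/(kernel_supp _ rJ0 Jpos); rewrite subrr enorm0 ltW.
  by apply: le_trans; rewrite subrr normr0.
have uB x : `|u x| <= m%:R * B.
  have [Ox|/u0->] := pselect (Omega x); last by rewrite normr0 mulr_ge0.
  have [y yb dE] := dist_to_attained x oOmega bOmega Omega0.
  apply: (@jump_chain_bound _ _ u B (kernel_radius J) m x y).
  - by move=> a b ab; apply: (jump_seminorm_ub uA); apply/(kernel_supp _ rJ0 Jpos).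
  - by apply: u0; exact: bdry_notin.
  - by rewrite -dE; apply: le_trans radm; exact: dist_to_inradius.
have Ox1 : Omega x1 by apply: contrapT => /u0 ux; rewrite ux eqxx in ux1.
have Ufin : Lp_norm Omega +oo%E u = U%:E.
  by rewrite fineK// ge0_fin_numE// /Lp_norm Lnorm_ge0.
have U0 : 0 < U.
  have h : 0 < `|u x1| by rewrite normr_gt0.
  have : ((`|u x1| / 2)%:E <= Lp_norm Omega +oo u)%E
    by apply: (Lp_norm_oo_ge oOmega cu Ox1); rewrite ltr_pdivrMr// ltr_pMr// ltr1n.
  rewrite Ufin lee_fin; apply: lt_le_trans; exact: divr_gt0.
have UA : U <= rad * A.
  by rewrite -lee_fin -Ufin; apply: Lp_norm_oo_le => //; rewrite mulr_ge0// ltW.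
have UB : U <= m%:R * B.
  by rewrite -lee_fin -Ufin; apply: Lp_norm_oo_le => //; rewrite mulr_ge0.
have mp : 0 < m%:R :> R by rewrite ltr0n.
rewrite ge_max; apply/andP; split; rewrite ler_pdivlMr// mulrC mulrA mulr1.
- by rewrite ler_pdivrMr// mulrC (le_trans UA)// ler_wpM2l ?(ltW rad0)// le_max lexx.
- by rewrite ler_pdivrMr// mulrC (le_trans UB)// ler_wpM2l// le_max lexx orbT.
Qed.

(** The cone over an inscribed ball of radius nearly rad: its slope is at most 1, and
its jumps are at most r because it is 1-Lipschitz and at most rad because its
values lie in [0, rad]. *)
Lemma cone_quotient (e : R) : 0 < e -> 5 * e < rad ->
  exists2 q, quotients q &
    q <= Num.max 1 (Num.min (kernel_radius J) rad) / (rad - 5 * e).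
Proof.
move=> e0 e5.
have [x0 x0O] : exists x, eball x (rad - e) `<=` Omega.
  by apply: inradius_adherent => //; move: e5; rewrite -/rad; lra.
(* the radius rad - 2e leaves room in the inscribed ball of radius rad - e; the
   smoothed apex loses at most 2e more, and the last e makes an inequality strict *)
have r0 : 0 < rad - 2 * e by lra.
have tc : test_function Omega (cone e x0 (rad - 2 * e)).
  by apply: (cone_test_function e0 _ x0O); lra.
set u := cone e x0 (rad - 2 * e) in tc *.
have W := test_function_W1oo0 oOmega tc.
have [cu u0 [_ uoo _ Goo _] _] := W.
have uc : rad - 4 * e <= `|u x0|.
  have /andP[c0 _] := cone_itv e0 x0 r0 x0.
  rewrite ger0_norm//; apply: le_trans (cone_center e0 x0 (rad - 2 * e)).
  by lra.
eexists; first by exists u, (grad u); split; [exact: W| |reflexivity];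
  exists x0; rewrite -normr_gt0; lra.
have c0 : 0 < rad - 5 * e by lra.
set A := fine (Lp_norm _ _ (fun x => _)); set B := jump_seminorm J u.
set U := fine _.
have Ufin : Lp_norm Omega +oo%E u = U%:E.
  by rewrite fineK// ge0_fin_numE// /Lp_norm Lnorm_ge0.
have Uc : rad - 5 * e <= U.
  rewrite -lee_fin -Ufin; apply: (Lp_norm_oo_ge oOmega cu (x := x0)); last by lra.
  by apply: x0O; apply: eball_center; lra.
have A1 : A <= 1.
  rewrite -lee_fin fineK; last by rewrite ge0_fin_numE// /Lp_norm Lnorm_ge0.
  apply: Lp_norm_oo_le => // x _; rewrite ger0_norm ?enorm_ge0//.
  exact: enorm_grad_cone.
have B1 : B <= Num.min (kernel_radius J) rad.
  apply: jump_seminorm_le; first by rewrite le_min (ltW rJ0) ltW//; move: e0 e5; lra.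
  move=> a b /(kernel_supp _ rJ0 Jpos) ab; rewrite le_min; apply/andP; split.
    by apply: le_trans ab; exact: cone_lipschitz.
  have /andP[a0 a1] := cone_itv e0 x0 r0 a; have /andP[b0 b1] := cone_itv e0 x0 r0 b.
  rewrite ler_norml; move: a0 a1 b0 b1; rewrite -/u; move: e0; lra.
have U0 : 0 < U := lt_le_trans c0 Uc.
apply: ler_pM.
- by rewrite le_max fine_Lp_norm_ge0.
- by rewrite invr_ge0 ltW.
- by rewrite ge_max !le_max A1 B1 orbT.
- by rewrite lef_pV2 ?posrE.
Qed.

Lemma quotients_nonempty : quotients !=set0.
Proof.
have rad0 : 0 < rad := inradius_gt0 oOmega bOmega Omega0.
have [||q qq _] := @cone_quotient (rad / 10); [by rewrite divr_gt0|lra|by exists q].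
Qed.

Lemma Lambda_lower_bound (m : nat) : (0 < m)%N ->
  rad <= m%:R * kernel_radius J -> Num.max (1 / rad) (1 / m%:R) <= Lambda Omega J.
Proof.
move=> m0 radm; apply: lb_le_inf; first exact: quotients_nonempty.
by move=> q; exact: quotient_lower_bound.
Qed.

(** Let e tend to 0 in cone_quotient. Multiplying by rad avoids divisions in this
limit. *)
Lemma Lambda_upper_bound :
  Lambda Omega J * rad <= Num.max 1 (Num.min (kernel_radius J) rad).
Proof.
have rad0 : 0 < rad := inradius_gt0 oOmega bOmega Omega0.
have lbq : lbound quotients 0.
  move=> q [u [G [_ _ ->]]]; rewrite divr_ge0 ?fine_Lp_norm_ge0//.
  by rewrite le_max fine_Lp_norm_ge0.
have L0 : 0 <= Lambda Omega J by apply: lb_le_inf => //; exact: quotients_nonempty.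
apply/ler_addgt0Pr => d d0.
set L := Lambda Omega J in L0 *.
(* 5 e < rad keeps the denominator positive, and 5 e L <= d bounds the loss in
   L * (rad - 5 e) *)
pose e := Num.min (rad / 10) (d / (5 * (L + 1))).
have D0 : 0 < 5 * (L + 1) by lra.
have e0 : 0 < e by rewrite lt_min !divr_gt0.
have e1 : e <= rad / 10 by rewrite ge_min lexx.
have e2 : e * (5 * (L + 1)) <= d.
  by rewrite -ler_pdivlMr// ge_min lexx orbT.
have e5 : 5 * e < rad by lra.
have [q qq qle] := cone_quotient e0 e5.
have Lq : L <= q by apply: ge_inf => //; exists 0.
have : L * (rad - 5 * e) <= Num.max 1 (Num.min (kernel_radius J) rad).
  by rewrite -ler_pdivlMr; [exact: le_trans Lq qle|lra].
by move: e2 e0; lra.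
Qed.

End eigenvalue_bounds.

Theorem theorem4p1 (R : realType) (n : nat) (alpha : R)
  (Omega : set 'rV[R]_n.+1) (J : 'rV[R]_n.+1 -> R) (K : nat) (b : R)
  (halpha : 0 < alpha <= 1)
  (Omega_nonempty : Omega !=set0)
  (Omega_open : open Omega)
  (Omega_connected : connected Omega)
  (Omega_bounded : bounded_set Omega)
  (Omega_boundary : C1alpha_boundary alpha Omega)
  (hJ : admissible_kernel J)
  (hb : 0 <= b < kernel_radius J)
  (hKb : inradius Omega = K%:R * kernel_radius J + b) :
  (b = 0 ->
     Lambda Omega J = Num.max (1 / inradius Omega) (1 / K%:R)) /\
  (K = 0%N \/ [/\ K <> 0%N, b <> 0 & kernel_radius J <= 1] ->
     Lambda Omega J = Num.max (1 / inradius Omega) (1 / (K%:R + 1))).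
Proof.
have /andP[b0 bJ] := hb.
have [_ [_ _ Jpos]] := hJ.
have rJ0 : 0 < kernel_radius J := le_lt_trans b0 bJ.
have rad0 := inradius_gt0 Omega_open Omega_bounded Omega_nonempty.
have upper := Lambda_upper_bound Omega_nonempty Omega_open Omega_bounded rJ0 Jpos.
have lower := Lambda_lower_bound Omega_nonempty Omega_open Omega_bounded rJ0 Jpos.
have sandwich (m : nat) : (0 < m)%N -> inradius Omega <= m%:R * kernel_radius J ->
    Num.max 1 (Num.min (kernel_radius J) (inradius Omega)) <=
      Num.max (1 / inradius Omega) (1 / m%:R) * inradius Omega ->
    Lambda Omega J = Num.max (1 / inradius Omega) (1 / m%:R).
  move=> m0 radm mx; apply/eqP; rewrite eq_le lower// andbT.
  by rewrite -(ler_pM2r rad0); exact: le_trans upper mx.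
have maxE c : Num.max (1 / inradius Omega) c * inradius Omega =
    Num.max 1 (c * inradius Omega).
  by rewrite maxr_pMl ?ltW// div1r mulVf// gt_eqF.
split.
- move=> bz; have K0 : (0 < K)%N.
    by rewrite lt0n; apply/eqP => Kz; move: rad0; rewrite hKb bz Kz mul0r addr0 ltxx.
  have Kp : 0 < K%:R :> R by rewrite ltr0n.
  apply: sandwich => //; first by rewrite hKb bz addr0.
  rewrite maxE ge_max !le_max lexx/=; apply/orP; right.
  rewrite ge_min; apply/orP; left.
  by rewrite hKb bz addr0 div1r mulKf// gt_eqF.
- rewrite natr1 => HK; apply: sandwich => //.
    by rewrite hKb -natr1 mulrDl mul1r lerD2l ltW.
  rewrite maxE ge_max !le_max lexx/=.
  case: HK => [K0|[_ _ rJ1]].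
    by rewrite K0 divr1 mul1r [X in _ || X]ge_min lexx !orbT.
  by rewrite ge_min rJ1.
Qed.
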